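(* Let $K$ be a quadratic field, imaginary or real, with ring of integers $\mathcal{O}$. Then, for every $k\in\mathbb{N}$ with $k\geqslant 2$, the set $\mathrm{stab}(V_k)$ is a group that is independent of $k$, namely the group $\mathrm{stab}(V_2)=\{m_{\varepsilon}\circ\sigma : \varepsilon\in\mathcal{O}^{\times},\ \sigma\in\mathrm{Gal}(K/\mathbb{Q})\}=\mathcal{O}^{\times}\rtimes\mathrm{Gal}(K/\mathbb{Q})$.
   Context: For $k\geqslant 2$, an element $0\neq x\in\mathcal{O}$ is $k$-free if $v_{\mathfrak{p}}(x)<k$ for all prime ideals $\mathfrak{p}$ of $\mathcal{O}$, where $v_{\mathfrak{p}}(x)$ is the exponent of $\mathfrak{p}$ in the prime ideal factorisation of $(x)$; $V_k$ is the set of all $k$-free elements of $\mathcal{O}$. $\mathrm{stab}(V_k)$ is the monoid (under composition) of all $\mathbb{Z}$-linear bijections $A$ of $\mathcal{O}$ with $A(V_k)\subseteq V_k$. For $\varepsilon\in\mathcal{O}^{\times}$, $m_{\varepsilon}$ denotes the map $x\mapsto\varepsilon x$ on $\mathcal{O}$; $\mathcal{O}^{\times}$ is identified with the group of these maps, and $\mathrm{Gal}(K/\mathbb{Q})$ acts on it by $\sigma\circ m_\varepsilon\circ\sigma^{-1}=m_{\sigma(\varepsilon)}$. *)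

(* Defs.v *)
From HB Require Import structures.
From mathcomp Require Import all_boot all_order all_algebra all_field.
From mathcomp Require Import ring_quotient.
From mathcomp Require Import boolp classical_sets.

Set Implicit Arguments.
Unset Strict Implicit.
Unset Printing Implicit Defensive.

Import GRing.Theory.

Local Open Scope ring_scope.

Definition ringInt (K : fieldExtType rat) : {pred K} :=
  fun x => `[< integralOver (intr : int -> K) x >].
Arguments ringInt : clear implicits.

Lemma ringInt_subring_closed (K : fieldExtType rat) :
  subring_closed (ringInt K).
Proof.
split; first by apply/asboolP; exact: integral1.
- by move=> x y /asboolP hx /asboolP hy; apply/asboolP; exact: integral_sub.
- by move=> x y /asboolP hx /asboolP hy; apply/asboolP; exact: integral_mul.
Qed.

HB.instance Definition _ (K : fieldExtType rat) :=
  GRing.isSubringClosed.Build K (ringInt K) (@ringInt_subring_closed K).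

Record intRing (K : fieldExtType rat) : predArgType := IntRing {
  intval :> K;
  intvalP : intval \in ringInt K
}.
Arguments intRing : clear implicits.

HB.instance Definition _ (K : fieldExtType rat) := [isSub for @intval K].
HB.instance Definition _ (K : fieldExtType rat) := [Choice of intRing K by <:].
HB.instance Definition _ (K : fieldExtType rat) :=
  [SubChoice_isSubComNzRing of intRing K by <:].

Section IntRingUnit.
Variable K : fieldExtType rat.

Definition int_unit : {pred intRing K} :=
  fun x => (x != 0) && ((val x)^-1 \in ringInt K).

Definition int_inv (x : intRing K) : intRing K :=
  if x \in int_unit then insubd x (val x)^-1 else x.

Lemma int_mulVx : {in int_unit, left_inverse 1 int_inv *%R}.
Proof.
move=> x ux; have /andP[x0 xV] := ux; apply: val_inj.
rewrite /int_inv ux rmorphM rmorph1 /= insubdK // mulVf //.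
Qed.

Lemma int_unitPl (x y : intRing K) : y * x = 1 -> int_unit x.
Proof.
move=> yx; have yx' : val y * val x = 1 by rewrite -rmorphM yx rmorph1.
apply/andP; split.
  by apply: contra_eq_neq yx => ->; rewrite mulr0 eq_sym oner_neq0.
suff -> : (val x)^-1 = val y by exact: valP.
have x0 : val x != 0.
  by apply: contra_eq_neq yx' => ->; rewrite mulr0 eq_sym oner_neq0.
by rewrite -[LHS]mul1r -yx' mulfK.
Qed.

Lemma int_inv_out : {in [predC int_unit], int_inv =1 id}.
Proof. by move=> x ux; rewrite /int_inv (negPf ux). Qed.

HB.instance Definition _ := GRing.ComNzRing_hasMulInverse.Build (intRing K)
  int_mulVx int_unitPl int_inv_out.

HB.instance Definition _ :=
  [SubComUnitRing_isSubIntegralDomain of intRing K by <:].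

End IntRingUnit.

Local Open Scope classical_set_scope.

Section Ideals.
Variable R : comNzRingType.

Definition principal_ideal (x : R) : set R := [set a * x | a in [set: R]].

Definition ideal_mul (I J : set R) : set R :=
  [set x | exists s : seq (R * R),
     (forall ab, ab \in s -> I ab.1 /\ J ab.2) /\
     x = \sum_(ab <- s) ab.1 * ab.2].

(* [idealr_closed] includes properness.  The zero ideal of a domain is allowed;
   it never occurs in a factorisation of a nonzero principal ideal. *)
Definition prime_ideal (P : set R) : Prop :=
  idealr_closed [in P] /\ prime_idealr_closed [in P].

Definition prime_factorisation (I : set R) (s : seq (set R)) : Prop :=
  (forall P, P \in s -> prime_ideal P) /\
  \big[ideal_mul/[set: R]]_(P <- s) P = I.

(* The exponent of P in the prime ideal factorisation of (x).  In a Dedekind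
   domain and for x != 0 the chosen list exists and is unique up to order; the
   default [::] is junk for the other cases. *)
Definition valuation (P : set R) (x : R) : nat :=
  count_mem P (xget [::] [set s | prime_factorisation (principal_ideal x) s]).

Definition kfree (k : nat) : set R :=
  [set x | x != 0 /\ forall P, prime_ideal P -> (valuation P x < k)%N].

Definition stab (V : set R) : set (R -> R) :=
  [set A | [/\ forall (n : int) (x y : R), A (x *~ n + y) = A x *~ n + A y,
               bijective A
             & A @` V `<=` V]].

Definition mul_map (e : R) : R -> R := fun x => e * x.

End Ideals.

Section MapGroups.
Variable T : Type.
Implicit Types N H G : set (T -> T).

Definition map_group G : Prop :=
  [/\ G id,
      forall f g, G f -> G g -> G (f \o g)
    & forall f, G f -> exists g, [/\ G g, cancel f g & cancel g f]].

Definition inner_sdprod N H G : Prop :=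
  [/\ [/\ map_group N, map_group H & map_group G],
      N `<=` G /\ H `<=` G,
      forall g g' n, G g -> cancel g g' -> cancel g' g -> N n ->
        N (g \o n \o g'),
      N `&` H = [set id]
    & G = [set n \o h | n in N & h in H]].

End MapGroups.

(* Gal(K / Q) is the type 'AEnd(K) of Q-algebra endomorphisms of K: these are
   automatically bijective, and 'Gal(_ / _) is only available once K carries a
   [splittingFieldType] structure. *)
Lemma kAut_AEnd (K : fieldExtType rat) (f : 'End(K)) :
  kAut 1 {:K} f <-> exists s : 'AEnd(K), f = s.
Proof.
rewrite kAutfE k1HomE; split=> [hf|[s ->]]; last exact: valP.
by exists (AHom hf).
Qed.

Lemma gal_int_subproof (K : fieldExtType rat) (s : 'AEnd(K)) (x : intRing K) :
    s (val x) \in ringInt K.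
Proof.
have /asboolP[p pm px] := valP x; apply/asboolP; exists p => //.
have -> : map_poly intr p = map_poly s (map_poly (intr : int -> K) p).
  by apply/polyP => i; rewrite !coef_map /= rmorph_int.
by rewrite fmorph_root.
Qed.

Definition gal_int (K : fieldExtType rat) (s : 'AEnd(K)) :
    intRing K -> intRing K :=
  fun x => IntRing (gal_int_subproof s x).

(* Main.v *)
(* Write O = Z + Z w, with norm form N(a + b w) = a^2 + t a b + n b^2 of
   discriminant D = t^2 - 4 n.  Let A be in stab(V_k).  If x is k-free and p is a
   prime not dividing D N(x), then p^(k-1) x is k-free, hence so is p^(k-1) A x,
   which forces p not to divide N(A x).  So the primes dividing the quadratic
   form Q = N o A at a k-free x divide D N(x).  If Q were not proportional to N,
   then at those x for which N(x) is squarefree and coprime to D, a resultant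
   bounds the common primes of Q(x) and N(x); since A x is k-free, their
   exponents in Q(x) are less than 2 k, so Q would be bounded at such x.  A sieve
   shows that it is not.  Hence Q is a multiple of N, A 1 is a unit e, and A / e
   fixes 1 and preserves N, so that it is an automorphism.  Conversely, units and
   automorphisms preserve k-freeness by unique factorisation of ideals, which for
   a quadratic order follows from Hurwitz's lemma: an ideal times its conjugate is
   generated by an integer. *)

Require Import Defs.
From HB Require Import structures.
From mathcomp Require Import all_boot all_order all_algebra all_field.
From mathcomp Require Import ring_quotient.
From mathcomp Require Import zify ring lra.
From mathcomp Require Import boolp classical_sets.

Set Implicit Arguments.
Unset Strict Implicit.
Unset Printing Implicit Defensive.

Import Order.TTheory GRing.Theory Num.Theory.

Local Open Scope ring_scope.

(** * Binary quadratic forms modulo p^2 and a squarefree sieve *)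

(** Only the inclusion of A(V_k) in V_k is given, so k-freeness says nothing directly about the
    inverse of A. Multiplication by p^(k-1) is the probe that works with this: A commutes with it,
    and at an unramified p it makes k-freeness detect coprimality to p, for every k alike. At a
    ramified p it has valuation 2(k-1) >= k and detects nothing, hence the exclusion of the primes
    dividing D. The probe runs one way, from primes of Q(x) to primes of N(x). So N(x) has to be
    controlled, while Q(x) only has to be large. This is why the sieve runs over a residue class,
    which fixes N(x) modulo D and the small primes, and over a box stretched along the axis where
    [al * a ^+ 2] dominates Q. An elementary count suffices because, for p prime to D, the points
    with p^2 dividing the norm lie in boundedly many lattices of index p^2, and the sum of the p^-2
    converges. Once Q is proportional to N, comparison of the three coefficients gives A w / A 1 the
    trace and the norm of w, which leaves only w and its conjugate. *)

Definition bform (al be ga a b : int) : int :=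
  al * a ^+ 2 + be * a * b + ga * b ^+ 2.

Section FormModSquare.
Variables (t n : int) (p : nat).
Hypotheses (p_pr : prime p) (pD : ~~ (p %| t ^+ 2 - 4 * n)%Z).
Let N := bform 1 t n.

Lemma Euclid_dvdzM (x y : int) : (p %| x * y)%Z = (p %| x)%Z || (p %| y)%Z.
Proof. by rewrite !dvdzE abszM Euclid_dvdM. Qed.

Lemma Gauss_dvdz_prime2 (x y : int) :
  ~~ (p %| x)%Z -> (p%:Z ^+ 2 %| x * y)%Z -> (p%:Z ^+ 2 %| y)%Z.
Proof.
move=> px; rewrite Gauss_dvdzr // coprimezXl // coprimezE /= prime_coprime //.
Qed.

Lemma bform_dvdl (u v : int) : (p %| N u v)%Z -> (p %| v)%Z -> (p %| u)%Z.
Proof.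
move=> pN /dvdzP[v' v'E]; have : (p %| u * u)%Z.
  have -> : u * u = N u v - (t * u * v' + n * v * v') * p%:Z.
    by rewrite /N /bform v'E; ring.
  by rewrite rpredB ?dvdz_mull.
by rewrite Euclid_dvdzM orbb.
Qed.

Lemma bform_dvd2 (u v : int) :
  (p %| u)%Z -> (p %| v)%Z -> (p%:Z ^+ 2 %| N u v)%Z.
Proof.
move=> /dvdzP[a ->] /dvdzP[b ->]; apply/dvdzP; exists (N a b).
by rewrite /N /bform; ring.
Qed.

Lemma bform_root_dvd2 (r u v : int) : (p%:Z ^+ 2 %| N r 1)%Z ->
  (p%:Z ^+ 2 %| u - r * v)%Z -> (p%:Z ^+ 2 %| N u v)%Z.
Proof.
move=> /dvdzP[f fE] /dvdzP[g gE]; have -> : u = g * p%:Z ^+ 2 + r * v by lia.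
apply/dvdzP; exists (g ^+ 2 * p%:Z ^+ 2 + 2 * g * r * v + t * g * v + f * v ^+ 2).
have -> : N (g * p%:Z ^+ 2 + r * v) v =
  g ^+ 2 * p%:Z ^+ 4 + 2 * g * r * v * p%:Z ^+ 2
  + t * g * v * p%:Z ^+ 2 + v ^+ 2 * N r 1 by rewrite /N /bform; ring.
by rewrite fE; ring.
Qed.

(** The form is homogeneous and [v] is invertible modulo p^2, so the zero (u, v) can be scaled to (u
    / v, 1). *)
Lemma bform_root_ex (u v : int) : (p%:Z ^+ 2 %| N u v)%Z -> ~~ (p %| v)%Z ->
  exists r, (p%:Z ^+ 2 %| N r 1)%Z.
Proof.
move=> pN pv; have cpv : coprimez v (p%:Z ^+ 2).
  by rewrite coprimezXr // coprimez_sym coprimezE /= prime_coprime.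
have /coprimezP[[x y] /= xyE] := cpv.
(* The Bezout coefficient [x] is the inverse of [v] modulo p^2. *)
exists (u * x); rewrite (@Gauss_dvdz_prime2 (v * v)) //.
  by rewrite Euclid_dvdzM orbb.
have -> : v * v * N (u * x) 1 = (x * v) ^+ 2 * N u v
    + (1 - x * v) * (t * u * v ^+ 2 * x + n * v ^+ 2 * (1 + x * v)).
  by rewrite /N /bform; ring.
have -> : 1 - x * v = y * p%:Z ^+ 2 by lia.
by rewrite rpredD ?(dvdz_mull _ pN) // dvdz_mulr // dvdz_mull.
Qed.

(* The elements with norm divisible by p^2 lie in three sublattices: pO and the
   lattices u = r v for the two roots r mod p^2 of the polynomial N(r, 1). *)
Lemma bform_dvd2_classes : exists kappa : int -> int -> 'I_3,
  forall u v u' v', (p%:Z ^+ 2 %| N u v)%Z -> (p%:Z ^+ 2 %| N u' v')%Z ->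
    kappa u v = kappa u' v' -> (p%:Z ^+ 2 %| N (u - u') (v - v'))%Z.
Proof.
have pdvd2 x : (p%:Z ^+ 2 %| x)%Z -> (p %| x)%Z.
  by apply: dvdz_trans; rewrite expr2 dvdz_mull.
have lat0 u v u' v' : (p%:Z ^+ 2 %| N u v)%Z -> (p%:Z ^+ 2 %| N u' v')%Z ->
    (p %| v)%Z -> (p %| v')%Z -> (p%:Z ^+ 2 %| N (u - u') (v - v'))%Z.
  move=> /pdvd2 pN /pdvd2 pN' pv pv'.
  by apply: bform_dvd2; rewrite rpredB // ?(bform_dvdl pN) ?(bform_dvdl pN').
have [[r rP]|noroot] := pselect (exists r, (p%:Z ^+ 2 %| N r 1)%Z); last first.
  have pv u v : (p%:Z ^+ 2 %| N u v)%Z -> (p %| v)%Z.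
    by move=> pN; apply/negPn/negP => /(bform_root_ex pN).
  by exists (fun _ _ => ord0) => u v u' v' pN pN' _; apply: lat0; eauto.
(* The second root, since the two roots of N(X, 1) = X^2 + t X + n have sum - t. *)
pose r' := - t - r.
have rP' : (p%:Z ^+ 2 %| N r' 1)%Z.
  suff -> : N r' 1 = N r 1 by [].
  by rewrite /r' /N /bform; ring.
have lat12 u v : (p%:Z ^+ 2 %| N u v)%Z -> ~~ (p %| v)%Z ->
    ~~ (p%:Z ^+ 2 %| u - r * v)%Z -> (p%:Z ^+ 2 %| u - r' * v)%Z.
  move=> pN pv pr.
  have prod : (p%:Z ^+ 2 %| (u - r' * v) * (u - r * v))%Z.
    have -> : (u - r' * v) * (u - r * v) = N u v - v ^+ 2 * N r 1.
      by rewrite /r' /N /bform; ring.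
    by rewrite rpredB // dvdz_mull.
  have [pr1|] := boolP (p %| u - r' * v)%Z; last first.
    by move=> /Gauss_dvdz_prime2 /(_ prod); rewrite (negPf pr).
  (* As (r - r')^2 = D + 4 N(r, 1), the roots stay distinct modulo a prime not dividing D. Hence p
     divides only one of the two factors, and that one absorbs p^2. *)
  have pr2 : ~~ (p %| u - r * v)%Z.
    apply/negP => pr2; have : (p %| (r - r') * v)%Z.
      have -> : (r - r') * v = (u - r' * v) - (u - r * v) by ring.
      by rewrite rpredB.
    rewrite Euclid_dvdzM (negPf pv) orbF => prr.
    case/negP: pD.
    have -> : t ^+ 2 - 4 * n = (r - r') * (r - r') - 4 * N r 1.
      by rewrite /r' /N /bform; ring.
    by apply: rpredB; [exact: dvdz_mulr | exact/dvdz_mull/pdvd2].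
  by move: prod; rewrite mulrC => /(Gauss_dvdz_prime2 pr2).
pose kappa u v : 'I_3 := if (p %| v)%Z then inord 0 else
   if (p%:Z ^+ 2 %| u - r * v)%Z then inord 1 else inord 2.
have inord_inj (i j : nat) : (inord i = inord j :> 'I_3) ->
    (i < 3)%N -> (j < 3)%N -> i = j.
  by move=> /(congr1 (@nat_of_ord 3)) + i3 j3; rewrite !inordK.
exists kappa => u v u' v' pN pN'; rewrite /kappa.
have [pv|pv] := boolP (p %| v)%Z; have [pv'|pv'] := boolP (p %| v')%Z.
- by move=> _; apply: lat0.
- by case: ifP => _ /inord_inj /(_ isT isT).
- by case: ifP => _ /inord_inj /(_ isT isT).
have [pr|pr] := boolP (_ %| u - _)%Z; have [pr'|pr'] := boolP (_ %| u' - _)%Z;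
  move=> /inord_inj /(_ isT isT) // _.
  apply: (@bform_root_dvd2 r) => //.
  have -> : u - u' - r * (v - v') = (u - r * v) - (u' - r * v') by ring.
  by rewrite rpredB.
apply: (@bform_root_dvd2 r') => //.
have -> : u - u' - r' * (v - v') = (u - r' * v) - (u' - r' * v') by ring.
by rewrite rpredB // lat12.
Qed.

End FormModSquare.

Lemma bform_bound (al be ga a b : int) (m : nat) :
    (`|a| <= m)%N -> (`|b| <= m)%N ->
  (`|bform al be ga a b| <= (`|al| + `|be| + `|ga|) * m ^ 2)%N.
Proof.
move=> am bm; rewrite /bform.
have bnd c x y : (`|x| <= m)%N -> (`|y| <= m)%N ->
    (absz (c * (x * y))%R <= `|c| * m ^ 2)%N.
  by move=> xm ym; rewrite !abszM leq_mul // -mulnn leq_mul.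
have := bnd al a a am am; have := bnd be a b am bm; have := bnd ga b b bm bm.
rewrite -!expr2 [be * (a * b)]mulrA !mulnDl; lia.
Qed.

Lemma divn_eq_dist (i j s : nat) : (i %/ s.+1 = j %/ s.+1)%N ->
  (`|i%:Z - j%:Z| <= s)%N.
Proof.
move=> e; have := divn_eq i s.+1; have := divn_eq j s.+1; rewrite e.
have : (i %% s.+1 < s.+1)%N by rewrite ltn_mod.
have : (j %% s.+1 < s.+1)%N by rewrite ltn_mod.
by move: (_ %% _)%N (_ %% _)%N (_ * _)%N => ? ? ?; clear; lia.
Qed.

(** * Points of a box whose norm is divisible by p^2 *)

Section FormCount.
Variables (t n : int).
Hypothesis N_aniso : forall a b, bform 1 t n a b = 0 -> a = 0 /\ b = 0.
Let N := bform 1 t n.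
Let c := (1 + `|t| + `|n|)%N.

(* Cells of side about p / c contain at most one point of each of the three
   sublattices on which p^2 divides the norm. *)
Lemma card_bform_dvd2 (p M X : nat) (u0 v0 : int) :
    prime p -> ~~ (p %| t ^+ 2 - 4 * n)%Z -> ~~ (p %| M)%N ->
  (#|[set x : 'I_X * 'I_X | (p%:Z ^+ 2 %| N (u0 + M%:Z * (x.1 : nat)%:Z)
                                           (v0 + M%:Z * (x.2 : nat)%:Z))%Z]|
     <= 3 * (X %/ (p.-1 %/ c).+1).+1 ^ 2)%N.
Proof.
(* Two points in a cell of side [s] differ by at most (p - 1) / c in each coordinate, so their
   difference has norm at most (p - 1)^2 / c < p^2. In a common class this norm is divisible by p^2,
   hence zero, and anisotropy identifies the points. *)
move=> p_pr pD pM; set B := [set x | _]; set s := (p.-1 %/ c).+1.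
have [kappa kappaP] := bform_dvd2_classes p_pr pD.
have pM' : ~~ (p %| M%:Z)%Z by rewrite dvdzE.
pose f (x : 'I_X * 'I_X) : 'I_(X %/ s).+1 * 'I_(X %/ s).+1 * 'I_3 :=
  (inord (x.1 %/ s), inord (x.2 %/ s),
   kappa (u0 + M%:Z * (x.1 : nat)%:Z) (v0 + M%:Z * (x.2 : nat)%:Z)).
have f_inj : {in B &, injective f}.
  move=> x y; rewrite !inE => xB yB [/(congr1 val) + /(congr1 val)].
  have cellP (i : 'I_X) : (i %/ s < (X %/ s).+1)%N.
    by rewrite ltnS leq_div2r // ltnW.
  rewrite /= !inordK // => e1 e2 /(kappaP _ _ _ _ xB yB).
  have near (i j : 'I_X) e := @divn_eq_dist i j (p.-1 %/ c) e.
  set d1 := (x.1 : nat)%:Z - (y.1 : nat)%:Z.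
  set d2 := (x.2 : nat)%:Z - (y.2 : nat)%:Z.
  have -> : bform 1 t n (u0 + M%:Z * (x.1 : nat)%:Z - (u0 + M%:Z * (y.1 : nat)%:Z))
      (v0 + M%:Z * (x.2 : nat)%:Z - (v0 + M%:Z * (y.2 : nat)%:Z)) =
      M%:Z * (M%:Z * N d1 d2) by rewrite /N /bform /d1 /d2; ring.
  do 2!move=> /(Gauss_dvdz_prime2 p_pr pM').
  have small : (`|N d1 d2| < p ^ 2)%N.
    apply: leq_ltn_trans (bform_bound _ _ _ (near _ _ e1) (near _ _ e2)) _.
    rewrite absz1 -/c /= -mulnn mulnA.
    have : (p.-1 %/ c * c <= p.-1)%N by exact: leq_trunc_div.
    have c_gt0 : (0 < c)%N by [].
    have p_gt0 : (0 < p)%N by exact: prime_gt0.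
    move: (p.-1 %/ c)%N => q qc; apply: (@leq_ltn_trans (p.-1 ^ 2)); last first.
      by rewrite ltn_exp2r // prednK.
    have -> : (c * q * q = (q * c) * q)%N by lia.
    by rewrite -mulnn leq_mul // (leq_trans _ qc) // leq_pmulr.
  move=> /dvdzP[z zE].
  have N0 : N d1 d2 = 0.
    have [z0|z0] := eqVneq z 0; first by rewrite zE z0 mul0r.
    have : (1 * p ^ 2 <= `|N d1 d2|)%N.
      by rewrite zE abszM abszX leq_mul // absz_gt0.
    by lia.
  have [d10 d20] := N_aniso N0.
  by case: x y @d1 @d2 d10 d20 {xB yB e1 e2 small zE N0} => x1 x2 [y1 y2] /=
    d10 d20; congr (_, _); apply: val_inj => /=; lia.
rewrite -(card_in_imset f_inj); apply: leq_trans (max_card _) _.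
by rewrite !card_prod !card_ord mulnn mulnC.
Qed.

End FormCount.

(** Telescoping, from (k + 1)^-2 <= 1 / k - 1 / (k + 1). *)
Lemma sum_inv_sqr_le (P d : nat) : (0 < P)%N ->
  \sum_(P.+1 <= i < P.+1 + d) (i%:R ^- 2 : rat) <= P%:R^-1 - (P + d)%:R^-1.
Proof.
move=> P0; elim: d => [|d IH]; first by rewrite addn0 big_geq // addn0 subrr.
rewrite addnS big_nat_recr /= ?leq_addr //.
apply: (le_trans (lerD IH (lexx _))).
rewrite addnS addSn; set k := (P + d)%N.
have k0 : (0 : rat) < k%:R by rewrite ltr0n /k addn_gt0 P0.
have k1 : (0 : rat) < k.+1%:R by rewrite ltr0n.
suff ? : (k.+1%:R : rat) ^- 2 <= k%:R^-1 - k.+1%:R^-1.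
  by rewrite -addrA lerD2l -lerBrDl opprK addrC.
have -> : k%:R^-1 - k.+1%:R^-1 = (k%:R * k.+1%:R : rat)^-1.
  by rewrite -natr1; field; rewrite natr1 !gt_eqF.
rewrite lef_pV2 ?posrE ?mulr_gt0 ?exprn_gt0 // expr2 ler_pM2r //.
by rewrite ler_nat.
Qed.

Lemma bform_discr_neq0 (t n : int) :
  (forall a b, bform 1 t n a b = 0 -> a = 0 /\ b = 0) -> t ^+ 2 - 4 * n != 0.
Proof.
(* The value of the form at (t, -2) is - D. *)
move=> N_aniso; apply/eqP => D0; suff /N_aniso[] : bform 1 t n t (-2) = 0 by [].
by rewrite /bform -oppr0 -D0; ring.
Qed.

(** With L = |be| + |ga| + 1 and L v <= u, the last two terms of L times the form cost at most (|be|
    + |ga|) u^2, against at least L u^2 from the first. What remains is at least u^2 >= u > L C0. *)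
Lemma bform_box_large (al be ga : int) (C0 u v : int) : al != 0 -> 0 <= v ->
    0 < u -> (`|be| + `|ga| + 1) * v <= u -> (`|be| + `|ga| + 1) * C0 < u ->
  C0 < `|bform al be ga u v|.
Proof.
set L := _ + 1 => al0 v0 u0 vu Cu.
have L0 : 0 < L by rewrite /L ltr_wpDl ?addr_ge0.
rewrite -(ltr_pM2l L0) (lt_le_trans Cu) //.
have vu' : v <= u.
  by apply: le_trans vu; rewrite ler_peMl // /L lerDr addr_ge0.
have H1 : u ^+ 2 <= `|al * u ^+ 2|.
  rewrite normrM [`|u ^+ 2|]ger0_norm ?sqr_ge0 // ler_peMl ?sqr_ge0 //.
  by rewrite -gtz0_ge1 normr_gt0.
have H2 : L * `|be * u * v| <= `|be| * u ^+ 2.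
  rewrite !normrM (gtr0_norm u0) (ger0_norm v0).
  have -> : L * (`|be| * u * v) = `|be| * u * (L * v) by ring.
  by rewrite expr2 [leRHS]mulrA ler_wpM2l // mulr_ge0 // ltW.
have H3 : L * `|ga * v ^+ 2| <= `|ga| * u ^+ 2.
  rewrite normrM [`|v ^+ 2|]ger0_norm ?sqr_ge0 //.
  have -> : L * (`|ga| * v ^+ 2) = `|ga| * (v * (L * v)) by ring.
  by rewrite ler_wpM2l // expr2 ler_pM // mulr_ge0 // ltW.
have H4 : u <= u ^+ 2 by rewrite expr2 ler_peMl ?(ltW u0) // -gtz0_ge1.
have H5 : L * `|al * u ^+ 2| - L * `|be * u * v| - L * `|ga * v ^+ 2|
    <= L * `|bform al be ga u v|.
  by rewrite -!mulrBr ler_pM2l // /bform; lia.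
have H6 : L * u ^+ 2 <= L * `|al * u ^+ 2| by rewrite ler_pM2l.
apply: le_trans H4 (le_trans _ H5).
have : L * u ^+ 2 = `|be| * u ^+ 2 + `|ga| * u ^+ 2 + u ^+ 2 by rewrite /L; ring.
by lia.
Qed.

(** * Squarefree values of the norm form *)

Section Sieve.
Variables (t n : int).
Hypothesis N_aniso : forall a b, bform 1 t n a b = 0 -> a = 0 /\ b = 0.
Let N := bform 1 t n.
Let D := t ^+ 2 - 4 * n.
Let c := (1 + `|t| + `|n|)%N.

(* The local densities are summed over [P < p <= Y] only: smaller primes divide
   the modulus M, larger ones have p^2 > |N|. *)
Lemma sieve_sum (X Y : nat) (P := (12 * c ^ 2)%N) :
  (12 * Y < X ^ 2)%N ->
  (\sum_(P.+1 <= p < P.+1 + Y) 3 * (X %/ (p.-1 %/ c).+1).+1 ^ 2 < X ^ 2)%N.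
Proof.
move=> YX; rewrite -(ltr_nat rat) natr_sum.
have c0 : (0 : rat) < c%:R by rewrite ltr0n.
have P0 : (0 < P)%N by rewrite muln_gt0 expn_gt0.
(* Here 3 (q + 1)^2 <= 6 q^2 + 6 with q <= c X / p. Summed over p > P, the first part is at most 6
   c^2 X^2 / P, which P = 12 c^2 makes X^2 / 2. The second part is 6 Y < X^2 / 2. *)
have termE p : (P < p)%N -> (3 * (X %/ (p.-1 %/ c).+1).+1 ^ 2)%:R <=
    6 * (c%:R ^+ 2 * X%:R ^+ 2) * (p%:R ^- 2) + 6 :> rat.
  move=> Pp; have p0 : (0 < p)%N by exact: leq_ltn_trans Pp.
  have p0' : (0 : rat) < p%:R by rewrite ltr0n.
  set s := (p.-1 %/ c).+1; set q := (X %/ s)%N.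
  have sp : (p <= s * c)%N by have := @ltn_ceil p.-1 c isT; rewrite prednK.
  have qp : (q%:R : rat) * p%:R <= c%:R * X%:R.
    rewrite -!natrM ler_nat; have : (q * s <= X)%N by exact: leq_trunc_div.
    move=> qs; apply: leq_trans (leq_mul (leqnn q) sp) _.
    by rewrite mulnA mulnC leq_mul.
  have qp' : (q%:R : rat) <= c%:R * X%:R / p%:R by rewrite ler_pdivlMr.
  have -> : 6 * (c%:R ^+ 2 * X%:R ^+ 2) * (p%:R ^- 2) =
      6 * (c%:R * X%:R / p%:R) ^+ 2 :> rat by field; lra.
  have q0 : (0 : rat) <= q%:R by rewrite ler0n.
  rewrite natrM natrX -[q.+1%:R]natr1.
  move: (c%:R * _ / _) (q%:R : rat) qp' q0 => z y yz y0.
  have yz2 : y ^+ 2 <= z ^+ 2 by rewrite ler_pXn2r ?nnegrE // (le_trans y0).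
  have := sqr_ge0 (y - 1); rewrite sqrrB1 sqrrD1.
  by move: (y ^+ 2) (z ^+ 2) yz2 => a b; lra.
have : \sum_(P.+1 <= p < P.+1 + Y) (3 * (X %/ (p.-1 %/ c).+1).+1 ^ 2)%:R <=
    \sum_(P.+1 <= p < P.+1 + Y)
      (6 * (c%:R ^+ 2 * X%:R ^+ 2) * (p%:R ^- 2) + 6) :> rat.
  by apply: ler_sum_nat => p /andP[Pp _]; exact: termE.
move/le_lt_trans; apply.
rewrite big_split /= -mulr_sumr sumr_const_nat addKn.
have S : \sum_(P.+1 <= i < P.+1 + Y) (i%:R ^- 2 : rat) <= P%:R^-1.
  by apply: le_trans (sum_inv_sqr_le _ P0) _; rewrite lerBlDr lerDl invr_ge0.
have PE : 6 * (c%:R ^+ 2 * X%:R ^+ 2) * P%:R^-1 = X%:R ^+ 2 / 2 :> rat.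
  by rewrite /P natrM natrX; field; lra.
have K0 : (0 : rat) <= 6 * (c%:R ^+ 2 * X%:R ^+ 2).
  by rewrite !mulr_ge0 ?exprn_ge0 ?ler0n.
have := ler_wpM2l K0 S; rewrite PE => H.
have YX' : 12 * Y%:R < X%:R ^+ 2 :> rat by rewrite -natrM -natrX ltr_nat.
rewrite natrX -[6 *+ Y]mulr_natr; move: YX' H.
by move: (X%:R ^+ 2) (\sum_(_ <= _ < _) _) => x2 S'; lra.
Qed.

(** The candidates are congruent to (1, 0) modulo [M], so their norms are 1 modulo [M], hence prime
    to D and to every prime up to [P]. The shift by M L X moves the box far out along the first
    axis, where [bform_box_large] applies. *)
Lemma squarefree_bform (al be ga : int) (C0 : nat) : al != 0 ->
  exists a b, [/\ coprimez (N a b) D,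
                  forall p : nat, prime p -> ~~ (p%:Z ^+ 2 %| N a b)%Z
                & (C0 < `|bform al be ga a b|)%N].
Proof.
move=> al0; have D0 : D != 0 by exact: bform_discr_neq0.
pose P := (12 * c ^ 2)%N; pose M := (`|D| * P`!)%N.
have M0 : (0 < M)%N by rewrite muln_gt0 absz_gt0 D0 fact_gt0.
pose L := (`|be| + `|ga| + 1)%N.
(* Coordinates are at most [m], so norms are at most c m^2, and p^2 can divide one only if p <= c m
   = Y. This [Y] is linear in [X]; the first summand of [X] ensures 12 Y < X^2, the summand [C0] the
   lower bound for the other form. *)
pose X := (12 * (c + c * M * L.+1) + C0 + 1)%N.
pose m := (1 + M * (L * X + X))%N; pose Y := (c * m)%N.
have X0 : (0 < X)%N by rewrite /X addn1.
pose u (x : 'I_X * 'I_X) : int := (1 + M * L * X)%N%:Z + M%:Z * (x.1 : nat)%:Z.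
pose v (x : 'I_X * 'I_X) : int := 0 + M%:Z * (x.2 : nat)%:Z.
pose B p := [set x | (p%:Z ^+ 2 %| N (u x) (v x))%Z].
have MN1 x : exists z, N (u x) (v x) = 1 + M%:Z * z.
  pose r := (L * X + x.1)%N%:Z; pose s := (x.2 : nat)%:Z.
  exists (2 * r + M%:Z * r ^+ 2 + t * s * (1 + M%:Z * r) + n * M%:Z * s ^+ 2).
  have -> : u x = 1 + M%:Z * r.
    by rewrite /u /r !PoszD !PoszM; ring.
  by rewrite /v /N /bform -/s add0r; ring.
have cop d x : (d %| M)%N -> coprimez (N (u x) (v x)) d%:Z.
  move=> dM; have [z ->] := MN1 x; apply/coprimezP.
  have [e ->] := dvdnP dM; exists (1, - (e%:Z * z)) => /=.
  by rewrite PoszM; ring.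
have BM p x : prime p -> x \in B p -> ~~ (p %| M)%N.
  move=> p_pr; rewrite inE => pN; apply/negP => /cop - /(_ x).
  rewrite coprimez_sym coprimezE /= prime_coprime // => /negP; apply.
  suff : (p%:Z %| N (u x) (v x))%Z by rewrite dvdzE.
  by apply: dvdz_trans pN; rewrite expr2 dvdz_mulr.
have Bsmall p x : prime p -> x \in B p -> (P < p)%N.
  move=> p_pr xB; rewrite ltnNge; apply/negP => pP.
  by case/negP: (BM _ _ p_pr xB); rewrite dvdn_mull // dvdn_fact // prime_gt0.
have Blarge p x : prime p -> x \in B p -> (p <= Y)%N.
  move=> p_pr; rewrite inE => pN.
  have N0 : N (u x) (v x) != 0.
    apply: contraTneq isT => /N_aniso[u0 _].
    by move: u0; rewrite /u -PoszM -PoszD => -[].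
  have um : (`|u x| <= m)%N.
    rewrite /u -PoszM -PoszD absz_nat /m -addnA leq_add2l -mulnA -mulnDr.
    by rewrite leq_mul2l leq_add2l (ltnW (ltn_ord _)) orbT.
  have vm : (`|v x| <= m)%N.
    rewrite /v add0r -PoszM absz_nat /m (leq_trans _ (leq_addl _ _)) //.
    by rewrite leq_mul2l (leq_trans (ltnW (ltn_ord _)) (leq_addl _ _)) orbT.
  have := bform_bound 1 t n um vm; rewrite absz1 -/c -/N => Nm.
  have : (p ^ 2 <= `|N (u x) (v x)|)%N.
    by rewrite dvdn_leq ?absz_gt0 //; move: pN; rewrite dvdzE abszX.
  move=> /leq_trans - /(_ _ Nm) pm.
  rewrite -(@leq_exp2r _ _ 2) // /Y expnMn (leq_trans pm) //.
  by rewrite leq_mul2r leq_pmulr ?orbT.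
(* Double counting: if each of the X^2 points lay in some [B p], the sizes of these sets for P < p
   <= Y would add up to at least X^2, against [sieve_sum]. *)
have [x xB] : exists x, forall p, prime p -> x \notin B p.
  apply/not_existsP => bad.
  have : (X ^ 2 <= \sum_(P.+1 <= p < P.+1 + Y)
                     3 * (X %/ (p.-1 %/ c).+1).+1 ^ 2)%N.
    have -> : (X ^ 2 = \sum_(x : 'I_X * 'I_X) 1)%N.
      by rewrite sum1_card card_prod card_ord mulnn.
    apply: (@leq_trans (\sum_(x : 'I_X * 'I_X)
                          \sum_(P.+1 <= p < P.+1 + Y | prime p) (x \in B p))).
      apply: leq_sum => x _; have /existsNP[p /not_implyP[p_pr]] := bad x.
      move=> /negP/negPn xB.
      have p_in : p \in index_iota P.+1 (P.+1 + Y).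
        rewrite mem_index_iota (Bsmall _ _ p_pr xB) /= addSn ltnS.
        by rewrite (leq_trans (Blarge _ _ p_pr xB)) ?leq_addl.
      by rewrite big_mkcond (bigD1_seq p) ?iota_uniq //= p_pr xB.
    rewrite exchange_big big_mkcond /=; apply: leq_sum => p _.
    case: ifP => // p_pr; rewrite -big_mkcond sum1_card.
    have [->|[y yB]] := set_0Vmem (B p); first by rewrite cards0.
    apply: card_bform_dvd2 => //; last exact: BM yB.
    apply: contraNN (BM _ _ p_pr yB); rewrite dvdzE => pD.
    by rewrite dvdn_mulr.
  apply/negP; rewrite -ltnNge sieve_sum //.
  apply: (@leq_ltn_trans (12 * (c + c * M * L.+1) * X)); last first.
    by rewrite -mulnn ltn_pmul2r // /X -addnA -[ltnLHS]addn0 ltn_add2l addn1.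
  rewrite /Y /m [(L * X + X)%N]addnC -mulSn -mulnA leq_mul2l /=.
  by rewrite mulnDl mulnDr muln1 !mulnA leq_add2r leq_pmulr.
exists (u x), (v x); split.
- have -> : coprimez (N (u x) (v x)) D = coprimez (N (u x) (v x)) `|D|%N%:Z.
    by rewrite !coprimezE absz_nat.
  exact/cop/dvdn_mulr.
- by move=> p /xB; rewrite inE.
rewrite -ltz_nat abszE; apply: bform_box_large => //.
- rewrite -!abszE -!PoszD -/L /v add0r /u -!(PoszM, PoszD) lez_nat.
  rewrite (leq_trans _ (leq_addr _ _)) // (leq_trans _ (leq_addl _ _)) //.
  by rewrite mulnCA mulnA leq_mul2l (ltnW (ltn_ord _)) orbT.
- rewrite -!abszE -!PoszD -/L /u -!(PoszM, PoszD) ltz_nat.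
  rewrite (leq_trans _ (leq_addr _ _)) // add1n ltnS -mulnA.
  rewrite (leq_trans _ (leq_pmull _ M0)) // leq_mul2l /X.
  by rewrite addn1 leqW ?orbT // leq_addl.
Qed.

End Sieve.

Local Open Scope classical_set_scope.
Local Open Scope ring_scope.

(** * Ideals *)

Section IdealArithmetic.
Variable R : idomainType.
Implicit Types (A B C I J L P Q : set R) (s : seq (set R)) (a x y : R).

(** Unlike [idealr_closed], this admits the whole ring, which is the empty product of ideals. *)
Definition is_ideal I : Prop :=
  I 0 /\ forall a x y, I x -> I y -> I (a * x + y).

Definition ideal_prod s : set R := \big[@ideal_mul R/[set: R]]_(P <- s) P.

Lemma is_idealD I x y : is_ideal I -> I x -> I y -> I (x + y).
Proof. by move=> [_ h] Ix Iy; rewrite -[x]mul1r; exact: h. Qed.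

Lemma is_idealM I a x : is_ideal I -> I x -> I (a * x).
Proof. by move=> [h0 h] Ix; rewrite -[a * x]addr0; exact: h. Qed.

Lemma is_idealMr I a x : is_ideal I -> I x -> I (x * a).
Proof. by rewrite mulrC; exact: is_idealM. Qed.

Lemma is_idealB I x y : is_ideal I -> I x -> I y -> I (x - y).
Proof. by move=> iI Ix Iy; rewrite -mulN1r addrC; exact: iI.2. Qed.

Lemma is_ideal_top I : is_ideal I -> I 1 -> I = setT.
Proof.
move=> iI I1; apply/seteqP; split=> // x _.
by rewrite -[x]mulr1; exact: is_idealM.
Qed.

Lemma is_ideal_principal x : is_ideal (principal_ideal x).
Proof.
split; first by exists 0; rewrite ?mul0r.
by move=> a _ _ [y _ <-] [z _ <-]; exists (a * y + z) => //; rewrite mulrDl mulrA.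
Qed.

Lemma mem_principal x : principal_ideal x x.
Proof. by exists 1 => //; rewrite mul1r. Qed.

Lemma mem_ideal_mul I J x y : I x -> J y -> ideal_mul I J (x * y).
Proof.
move=> Ix Jy; exists [:: (x, y)]; split; last by rewrite big_seq1.
by move=> ab; rewrite inE => /eqP ->.
Qed.

(** Serves as the induction principle for products: [L] may be any additively closed predicate, not
    only an ideal. *)
Lemma ideal_mul_sub I J (L : set R) : L 0 ->
    (forall x y, L x -> L y -> L (x + y)) ->
    (forall x y, I x -> J y -> L (x * y)) ->
  ideal_mul I J `<=` L.
Proof.
move=> L0 LD IJL _ [s [sIJ ->]]; rewrite big_seq.
elim/big_ind: _ => // ab /sIJ[]; exact: IJL.
Qed.

Lemma ideal_mul0 I J : ideal_mul I J 0.
Proof. by exists [::]; split=> //; rewrite big_nil. Qed.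

Lemma ideal_mulD I J x y :
  ideal_mul I J x -> ideal_mul I J y -> ideal_mul I J (x + y).
Proof.
move=> [s [sP ->]] [r [rP ->]]; exists (s ++ r); split; last by rewrite big_cat.
by move=> ab; rewrite mem_cat => /orP[/sP|/rP].
Qed.

Lemma ideal_mulS I J I' J' :
  I `<=` I' -> J `<=` J' -> ideal_mul I J `<=` ideal_mul I' J'.
Proof.
move=> sI sJ; apply: ideal_mul_sub; first exact: ideal_mul0.
  exact: ideal_mulD.
by move=> x y /sI Ix /sJ Jy; exact: mem_ideal_mul.
Qed.

Lemma ideal_mulC I J : ideal_mul I J = ideal_mul J I.
Proof.
suff sub A B : ideal_mul A B `<=` ideal_mul B A by apply/seteqP; split.
apply: ideal_mul_sub; [exact: ideal_mul0 | exact: ideal_mulD|].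
by move=> x y Ax By; rewrite mulrC; exact: mem_ideal_mul.
Qed.

Lemma ideal_mulA I J L :
  ideal_mul I (ideal_mul J L) = ideal_mul (ideal_mul I J) L.
Proof.
have sub A B C : ideal_mul A (ideal_mul B C) `<=` ideal_mul (ideal_mul A B) C.
  apply: ideal_mul_sub; [exact: ideal_mul0 | exact: ideal_mulD|].
  move=> x y Ax; move: y.
  apply: (@ideal_mul_sub _ _ [set y | ideal_mul (ideal_mul A B) C (x * y)]) => /=.
  - by rewrite mulr0; exact: ideal_mul0.
  - by move=> y z; rewrite mulrDr; exact: ideal_mulD.
  by move=> y z By Cz; rewrite mulrA; do 2!apply: mem_ideal_mul => //.
apply/seteqP; split; first exact: sub.
rewrite (ideal_mulC I (ideal_mul J L)) (ideal_mulC J L).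
by rewrite (ideal_mulC _ L) (ideal_mulC I J); exact: sub.
Qed.

Lemma ideal_mulT I : is_ideal I -> ideal_mul I setT = I.
Proof.
move=> iI; apply/seteqP; split.
  apply: ideal_mul_sub; [exact: iI.1 | by move=> *; apply: is_idealD|].
  by move=> x y Ix _; apply: is_idealMr.
by move=> x Ix; rewrite -[x]mulr1; exact: mem_ideal_mul.
Qed.

Lemma is_ideal_mul I J : is_ideal I -> is_ideal (ideal_mul I J).
Proof.
move=> iI; split=> [|a x y]; first exact: ideal_mul0.
move=> IJx IJy; apply: ideal_mulD IJy.
move: x IJx; apply: (@ideal_mul_sub _ _ [set x | ideal_mul I J (a * x)]) => /=.
- by rewrite mulr0; exact: ideal_mul0.
- by move=> y' z; rewrite mulrDr; exact: ideal_mulD.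
- move=> x y' Ix Jy; rewrite mulrA.
  by apply: mem_ideal_mul => //; exact: is_idealM.
Qed.

Lemma ideal_mul_subl I J : is_ideal I -> ideal_mul I J `<=` I.
Proof.
by move=> iI; rewrite -[X in _ `<=` X](ideal_mulT iI); exact: ideal_mulS.
Qed.

Lemma principal_mulE x I : is_ideal I ->
  ideal_mul (principal_ideal x) I = [set x * y | y in I].
Proof.
move=> iI; apply/seteqP; split.
  apply: ideal_mul_sub.
  - by exists 0; rewrite ?mulr0 //; exact: iI.1.
  - by move=> _ _ [y Iy <-] [z Iz <-]; exists (y + z); rewrite ?mulrDr //;
       exact: is_idealD.
  - move=> _ y [a _ <-] Iy; exists (a * y); first exact: is_idealM.
    by rewrite mulrCA mulrA.
by move=> _ [y Iy <-]; apply: mem_ideal_mul => //; exact: mem_principal.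
Qed.

Lemma principalM x y :
  principal_ideal (x * y) = ideal_mul (principal_ideal x) (principal_ideal y).
Proof.
rewrite (principal_mulE _ (is_ideal_principal y)); apply/seteqP; split.
  by move=> _ [a _ <-]; exists (a * y); [exists a|rewrite mulrCA].
by move=> _ [_ [a _ <-] <-]; exists a => //; rewrite mulrCA.
Qed.

Lemma principal_cancel x I J : x != 0 -> is_ideal I -> is_ideal J ->
  ideal_mul (principal_ideal x) I = ideal_mul (principal_ideal x) J -> I = J.
Proof.
move=> x0 iI iJ; rewrite !principal_mulE // => e.
have sub (A B : set R) :
    [set x * y | y in A] = [set x * y | y in B] -> A `<=` B.
  move=> E y Ay; have : [set x * y | y in A] (x * y) by exists y.
  by rewrite E => -[z Bz /(mulfI x0) <-].
by apply/seteqP; split; exact: sub.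
Qed.

Lemma is_ideal_prod s :
  (forall P, P \in s -> is_ideal P) -> is_ideal (ideal_prod s).
Proof.
rewrite /ideal_prod; case: s => [|P s] h; rewrite ?big_nil //.
by rewrite big_cons; apply/is_ideal_mul/h; rewrite mem_head.
Qed.

Lemma ideal_prod_cat s1 s2 : (forall P, P \in s2 -> is_ideal P) ->
  ideal_prod (s1 ++ s2) = ideal_mul (ideal_prod s1) (ideal_prod s2).
Proof.
move=> h; elim: s1 => [|P s1 IH]; rewrite /ideal_prod /=.
  by rewrite big_nil ideal_mulC ideal_mulT //; exact: is_ideal_prod.
by rewrite !big_cons; rewrite /ideal_prod in IH; rewrite IH ideal_mulA.
Qed.

Lemma ideal_prod_rem P s : P \in s ->
  ideal_prod s = ideal_mul P (ideal_prod (rem P s)).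
Proof.
rewrite /ideal_prod; elim: s => //= Q s IH; rewrite inE big_cons.
have [-> //|_] /= := eqVneq P Q; move=> Ps; rewrite (IH Ps).
by rewrite big_cons !ideal_mulA (ideal_mulC Q).
Qed.

Lemma prime_idealP P : prime_ideal P <->
  [/\ is_ideal P, ~ P 1 & forall x y, P (x * y) -> P x \/ P y].
Proof.
split.
  move=> [[P0 P1 PD] Pp]; split; first split.
  - exact: set_mem.
  - move=> a x y /mem_set Px /mem_set Py; apply: set_mem; exact: PD.
  - by move=> /mem_set; rewrite (negPf P1).
  - by move=> x y /mem_set /Pp /orP[/set_mem|/set_mem]; [left|right].
move=> [[P0 PD] P1 Pp]; split; first split.
- exact: mem_set.
- by apply/negP => /set_mem.
- by move=> a x y /set_mem Px /set_mem Py; apply: mem_set; exact: PD.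
move=> x y /set_mem /Pp[] /mem_set; rewrite !unfold_in => ->; rewrite ?orbT //.
Qed.

Lemma prime_is_ideal P : prime_ideal P -> is_ideal P.
Proof. by case/prime_idealP. Qed.

Lemma prime_ideal_mul P I J : prime_ideal P -> ideal_mul I J `<=` P ->
  I `<=` P \/ J `<=` P.
Proof.
move=> /prime_idealP[iP P1 Pp] IJP.
have [?|/existsNP[x /not_implyP[Ix Px]]] := pselect (I `<=` P); first by left.
right=> y Jy.
by have [] := Pp _ _ (IJP _ (mem_ideal_mul Ix Jy)).
Qed.

Lemma prime_ideal_prod P s : prime_ideal P -> ideal_prod s `<=` P ->
  exists2 Q, Q \in s & Q `<=` P.
Proof.
move=> pP; rewrite /ideal_prod; elim: s => [|Q s IH].
  by rewrite big_nil => /(_ 1 I) P1; have /prime_idealP[] := pP.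
rewrite big_cons => /(prime_ideal_mul pP)[QP|/IH[L Ls LP]].
  by exists Q; rewrite ?mem_head.
by exists L; rewrite // inE Ls orbT.
Qed.

Lemma ideal_prod_sub s P : (forall P, P \in s -> is_ideal P) -> P \in s ->
  ideal_prod s `<=` P.
Proof.
by move=> h Ps; rewrite (ideal_prod_rem Ps); exact: ideal_mul_subl (h _ Ps).
Qed.

End IdealArithmetic.

(** * Quadratic orders *)

Lemma int_subgroup (S : set int) : S 0 -> (forall x y, S x -> S y -> S (x - y)) ->
  exists d : int, forall x, S x <-> (d %| x)%Z.
Proof.
move=> S0 SB.
have SN x : S x -> S (- x) by move=> Sx; rewrite -sub0r; exact: SB.
have SD x y : S x -> S y -> S (x + y).
  by move=> Sx /SN Sy; rewrite -[y]opprK; exact: SB.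
have SM x (k : int) : S x -> S (k * x).
  move=> Sx; have SMn (m : nat) : S (m%:Z * x).
    elim: m => [|m IH]; first by rewrite mul0r.
    by rewrite -addn1 PoszD mulrDl mul1r; exact: SD.
  by case: k => m; [exact: SMn | rewrite NegzE mulNr; exact/SN/SMn].
have [[d [d0 Sd]]|none] := pselect (exists d : nat, (0 < d)%N /\ S d); last first.
  exists 0 => x; rewrite dvd0z; split=> [Sx|/eqP->//].
  apply/negPn/negP => x0; apply: none; exists `|x|%N.
  rewrite absz_gt0 x0; split=> //; rewrite abszE.
  by case: (ger0P x) => _ //; exact: SN.
have exd : exists d : nat, `[< (0 < d)%N /\ S d >] by exists d; apply/asboolP.
case: (ex_minnP exd) => m /asboolP[m0 Sm] mmin.
have m0' : m%:Z != 0 by case: m m0 {Sm mmin}.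
exists m => x; split=> [Sx|/dvdzP[k ->]]; last exact: SM.
have Sr : S (x %% m)%Z.
  have -> : (x %% m)%Z = x - (x %/ m)%Z * m by rewrite {2}(divz_eq x m); ring.
  exact/SB/SM.
have := ltz_mod x m0'; have := modz_ge0 x m0'.
case E: (x %% m)%Z Sr => // [[|r]] Sr _; first by move=> _; apply/dvdz_mod0P.
have /mmin : `[< (0 < r.+1)%N /\ S r.+1 >] by apply/asboolP.
by move=> mr; rewrite ltz_nat absz_nat ltnNge mr.
Qed.

(* t and n are the trace and norm of w; [quad_normal] says that R is integrally
   closed. *)
Record quadratic_order (R : idomainType) (cj : {rmorphism R -> R}) (w : R)
    (t n : int) : Prop := QuadraticOrder {
  quad_sqr : w * w = t%:~R * w - n%:~R;
  quad_span : forall x : R, exists a b : int, x = a%:~R + b%:~R * w;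
  quad_free : forall a b : int, a%:~R + b%:~R * w = 0 -> a = 0 /\ b = 0;
  quad_conj : cj w = t%:~R - w;
  quad_normal : forall a b g : int, g != 0 -> (g %| 2 * a + t * b)%Z ->
    (g ^+ 2 %| bform 1 t n a b)%Z -> (g %| a)%Z /\ (g %| b)%Z }.

Section QuadraticOrder.
Variables (R : idomainType) (cj : {rmorphism R -> R}) (w : R) (t n : int).
Hypothesis QR : quadratic_order cj w t n.
Implicit Types (A B C I J L P Q : set R) (s : seq (set R)) (x y z : R).
Let N := bform 1 t n.

Definition quad_elt (a b : int) : R := a%:~R + b%:~R * w.

Lemma quad_eltP x : exists a b, x = quad_elt a b.
Proof. exact: quad_span QR x. Qed.

Lemma quad_elt_inj a b a' b' :
  quad_elt a b = quad_elt a' b' -> a = a' /\ b = b'.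
Proof.
move=> e; suff /(quad_free QR)[] : quad_elt (a - a') (b - b') = 0 by lia.
rewrite -[RHS](subrr (quad_elt a b)) {2}e /quad_elt !rmorphB /=; ring.
Qed.

Lemma quad_int a : quad_elt a 0 = a%:~R.
Proof. by rewrite /quad_elt mul0r addr0. Qed.

Lemma quad_int_inj : injective (intr : int -> R).
Proof. by move=> a b; rewrite -!quad_int => /quad_elt_inj[]. Qed.

Lemma quad_intM (g a b : int) : g%:~R * quad_elt a b = quad_elt (g * a) (g * b).
Proof. by rewrite /quad_elt !rmorphM /=; ring. Qed.

Lemma quad_dvd_int (g m : int) x : m%:~R = g%:~R * x -> (g %| m)%Z.
Proof.
have [a [b ->]] := quad_eltP x.
rewrite quad_intM -quad_int => /quad_elt_inj[-> _].
by rewrite dvdz_mulr.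
Qed.

Lemma quad_cjE a b : cj (quad_elt a b) = quad_elt (a + t * b) (- b).
Proof.
rewrite /quad_elt rmorphD rmorphM /= !rmorph_int (quad_conj QR).
by rewrite !rmorphD !rmorphN !rmorphM /=; ring.
Qed.

Lemma quad_cjK : involutive cj.
Proof.
move=> x; have [a [b ->]] := quad_eltP x.
by rewrite !quad_cjE; congr quad_elt; ring.
Qed.

Lemma quad_normE a b : quad_elt a b * cj (quad_elt a b) = (N a b)%:~R.
Proof.
rewrite quad_cjE /quad_elt /N /bform !(rmorphD, rmorphN, rmorphM, rmorphXn) /=.
transitivity (a%:~R ^+ 2 + t%:~R * a%:~R * b%:~R
    + t%:~R * b%:~R * (b%:~R * w) - b%:~R ^+ 2 * (w * w)); first by ring.
by rewrite (quad_sqr QR); ring.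
Qed.

Lemma quad_norm_ex x : exists m : int, x * cj x = m%:~R.
Proof. by have [a [b ->]] := quad_eltP x; exists (N a b); exact: quad_normE. Qed.

Lemma quad_trace_ex x : exists m : int, x + cj x = m%:~R.
Proof.
have [a [b ->]] := quad_eltP x; exists (2 * a + t * b).
rewrite quad_cjE -quad_int /quad_elt !(rmorphD, rmorphN, rmorphM) /=; ring.
Qed.

Lemma quad_cj_eq0 x : (cj x == 0) = (x == 0).
Proof.
apply/eqP/eqP => [e|->]; last exact: rmorph0.
by rewrite -[x]quad_cjK e rmorph0.
Qed.

Lemma quad_norm_aniso a b : N a b = 0 -> a = 0 /\ b = 0.
Proof.
move=> N0; have /eqP := quad_normE a b; rewrite N0 mulf_eq0 quad_cj_eq0 orbb.
by move=> /eqP; exact: quad_free QR a b.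
Qed.

(** Hermite normal form: one generator is the integer [d0] generating the integers of I, the other
    an element whose w-coordinate [d1] generates all w-coordinates of I. [d0] is nonzero because I
    contains the norm of [x0]. *)
Lemma quad_ideal_gen2 I : is_ideal I -> (exists2 x, x != 0 & I x) ->
  exists a b : R, [/\ a != 0, I a, I b &
    forall x, I x -> exists u v, x = u * a + v * b].
Proof.
move=> iI [x0 x0n0 Ix0].
have [d0 d0P] : exists d : int, forall a, I a%:~R <-> (d %| a)%Z.
  apply: (@int_subgroup [set a : int | I a%:~R]); first exact: iI.1.
  by move=> a b /= Ia Ib; rewrite rmorphB; exact: is_idealB.
have [d1 d1P] : exists d : int,
    forall b, (exists a, I (quad_elt a b)) <-> (d %| b)%Z.
  apply: (@int_subgroup [set b : int | exists a, I (quad_elt a b)]).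
    by exists 0; rewrite quad_int; exact: iI.1.
  move=> b b' [a Ia] [a' Ia']; exists (a - a').
  have -> : quad_elt (a - a') (b - b') = quad_elt a b - quad_elt a' b'.
    by rewrite /quad_elt !rmorphB /=; ring.
  exact: is_idealB.
have [a1 Ia1] := (d1P d1).2 (dvdzz _).
exists d0%:~R, (quad_elt a1 d1); split=> //; last first.
- move=> x Ix; have [a [b xE]] := quad_eltP x.
  have /d1P/dvdzP[v vE] : exists a, I (quad_elt a b) by exists a; rewrite -xE.
  have xv : x - v%:~R * quad_elt a1 d1 = (a - v * a1)%:~R.
    by rewrite xE vE /quad_elt !rmorphB !rmorphM /=; ring.
  have /d0P/dvdzP[u uE] : I (a - v * a1)%:~R.
    by rewrite -xv; apply: is_idealB => //; exact: is_idealM.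
  exists u%:~R, v%:~R; rewrite -rmorphM /= -uE -xv; ring.
- by apply/d0P.
- have [m mE] := quad_norm_ex x0.
  have /d0P/dvdzP[k kE] : I m%:~R by rewrite -mE; exact: is_idealMr.
  apply: contra_neq (x0n0) => d00; apply/eqP.
  have /eqP : x0 * cj x0 = 0 by rewrite mE kE rmorphM /= d00 mulr0.
  by rewrite mulf_eq0 quad_cj_eq0 orbb.
Qed.

(** The absolute norm, described through the conjugate ideal rather than as an index: this is the
    form in which it makes ideals invertible. *)
Definition ideal_norm I (g : nat) : Prop :=
  (0 < g)%N /\ ideal_mul I (cj @` I) = principal_ideal (g%:Z%:~R : R).

(* Hurwitz: if I = (a, b) then I times its conjugate is generated by the gcd g
   of the integers N a, N b and Tr (a cj b), because a cj b / g is integral. *)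
Lemma ideal_norm_ex I : is_ideal I -> (exists2 x, x != 0 & I x) ->
  exists g, ideal_norm I g.
Proof.
move=> iI nzI; have [a [b [a0 Ia Ib gen]]] := quad_ideal_gen2 iI nzI.
have [A AE] := quad_norm_ex a; have [B BE] := quad_norm_ex b.
have [T TE] := quad_trace_ex (a * cj b).
have [c [d yE]] := quad_eltP (a * cj b).
have cdT : 2 * c + t * d = T.
  apply: quad_int_inj; rewrite -TE yE quad_cjE -quad_int /quad_elt.
  by rewrite !(rmorphD, rmorphN, rmorphM) /=; ring.
have cdN : N c d = A * B.
  apply: quad_int_inj; rewrite -quad_normE -yE rmorphM rmorphM quad_cjK /=.
  by rewrite -AE -BE; ring.
have A0 : A != 0.
  apply: contra_neq (a0) => A0; apply/eqP; move/eqP: AE.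
  by rewrite A0 mulf_eq0 quad_cj_eq0 orbb.
pose g := gcdz (gcdz A B) T.
have g0 : g != 0 by rewrite !gcdz_eq0 (negPf A0).
have gA : (g %| A)%Z by rewrite (dvdz_trans (dvdz_gcdl _ _)) // dvdz_gcdl.
have gB : (g %| B)%Z by rewrite (dvdz_trans (dvdz_gcdl _ _)) // dvdz_gcdr.
have gT : (g %| T)%Z by exact: dvdz_gcdr.
have [gc gd] : (g %| c)%Z /\ (g %| d)%Z.
  apply: (quad_normal QR) => //; first by rewrite cdT.
  by rewrite -/N cdN expr2 dvdz_mul.
have principal_g (m : int) : (g %| m)%Z -> principal_ideal (g%:~R : R) m%:~R.
  by move=> /dvdzP[k ->]; exists k%:~R; rewrite // rmorphM.
have ig := is_ideal_principal (g%:~R : R).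
have gy : principal_ideal (g%:~R : R) (a * cj b).
  rewrite yE /quad_elt; apply: is_idealD => //; first exact: principal_g.
  by apply: is_idealMr => //; exact: principal_g.
have gcj x : principal_ideal (g%:~R : R) x -> principal_ideal (g%:~R : R) (cj x).
  by move=> [z _ <-]; exists (cj z); rewrite // rmorphM rmorph_int.
have gabs : g = `|g|%N%:Z by rewrite abszE ger0_norm.
exists `|g|%N; split; first by rewrite absz_gt0.
rewrite -gabs; apply/seteqP; split.
  apply: ideal_mul_sub; [exact: ig.1 | by move=> *; exact: is_idealD|].
  move=> _ _ /gen[u [v ->]] [_ /gen[u' [v' ->]] <-].
  have -> : (u * a + v * b) * cj (u' * a + v' * b) =
    u * cj u' * A%:~R + v * cj v' * B%:~R
    + u * cj v' * (a * cj b) + v * cj u' * cj (a * cj b).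
    by rewrite -AE -BE rmorphD !rmorphM /= quad_cjK; ring.
  by do 3?[apply: is_idealD => //]; apply: is_idealM => //;
    [exact: principal_g | exact: principal_g | exact: gcj].
have iM : is_ideal (ideal_mul I (cj @` I)) by exact: is_ideal_mul.
move=> _ [x _ <-]; apply: is_idealM => //.
have cjI z : I z -> (cj @` I) (cj z) by move=> Iz; exists z.
have [u [v uvE]] := Bezoutz (gcdz A B) T.
have [u' [v' uvE']] := Bezoutz A B.
rewrite /g -uvE -uvE' !(rmorphD, rmorphM) /= -AE -BE -TE.
rewrite [cj (a * cj b)]rmorphM /= quad_cjK [cj a * b]mulrC.
have MD := is_idealD iM; have MM := is_idealM _ iM.
have Mab y z : I y -> I z -> ideal_mul I (cj @` I) (y * cj z).
  by move=> Iy Iz; exact: mem_ideal_mul (cjI _ Iz).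
have Maa := Mab _ _ Ia Ia; have Mbb := Mab _ _ Ib Ib.
have Mba := Mab _ _ Ib Ia; have {}Mab := Mab _ _ Ia Ib.
by apply: (MD); apply: (MM); apply: (MD) => //; exact: MM.
Qed.

End QuadraticOrder.

(** * Transport of ideals along a ring automorphism *)

Section Automorphism.
Variables (R : idomainType) (f g : {rmorphism R -> R}).
Hypotheses (fK : cancel f g) (gK : cancel g f).
Implicit Types (I J P : set R) (s : seq (set R)) (x y : R).

Lemma image_ideal_mul I J :
  f @` (ideal_mul I J) = ideal_mul (f @` I) (f @` J).
Proof.
apply/seteqP; split.
  move=> _ [x IJx <-]; move: x IJx.
  apply: (@ideal_mul_sub _ _ _ [set x | ideal_mul (f @` I) (f @` J) (f x)]) => /=.
  - by rewrite rmorph0; exact: ideal_mul0.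
  - by move=> x y; rewrite rmorphD; exact: ideal_mulD.
  - move=> x y Ix Jy; rewrite rmorphM.
    by apply: mem_ideal_mul; [exists x | exists y].
apply: ideal_mul_sub.
- by exists 0; rewrite ?rmorph0 //; exact: ideal_mul0.
- move=> _ _ [x Ix <-] [y Iy <-].
  by exists (x + y); rewrite ?rmorphD //; exact: ideal_mulD.
- move=> _ _ [x Ix <-] [y Iy <-].
  by exists (x * y); rewrite ?rmorphM //; exact: mem_ideal_mul.
Qed.

Lemma image_automE I : f @` I = [set x | I (g x)].
Proof.
apply/seteqP; split; first by move=> _ [x Ix <-] /=; rewrite fK.
by move=> x Ix; exists (g x).
Qed.

Lemma image_autom_inj : injective (fun I => f @` I).
Proof.
have sub I J : f @` I = f @` J -> I `<=` J.
  move=> e x Ix; have : (f @` I) (f x) by exists x.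
  by rewrite e => -[y Jy /(can_inj fK) <-].
by move=> I J e; apply/seteqP; split; exact: sub.
Qed.

Lemma is_ideal_image I : is_ideal I -> is_ideal (f @` I).
Proof.
move=> iI; rewrite image_automE; split=> [|a x y] /=.
  by rewrite rmorph0; exact: iI.1.
by rewrite rmorphD rmorphM; exact: iI.2.
Qed.

Lemma prime_ideal_image P : prime_ideal P -> prime_ideal (f @` P).
Proof.
move=> /prime_idealP[iP P1 Pp]; apply/prime_idealP; split.
- exact: is_ideal_image.
- by rewrite image_automE /= rmorph1.
- by rewrite image_automE => x y /=; rewrite rmorphM; exact: Pp.
Qed.

Lemma image_principal x : f @` principal_ideal x = principal_ideal (f x).
Proof.
apply/seteqP; split.
  by move=> _ [_ [a _ <-] <-]; exists (f a); rewrite ?rmorphM.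
move=> _ [a _ <-]; exists (g a * x); last by rewrite rmorphM gK.
by exists (g a).
Qed.

Lemma image_ideal_prod s :
  f @` ideal_prod s = ideal_prod [seq f @` P | P <- s].
Proof.
rewrite /ideal_prod; elim: s => [|P s IH]; last first.
  by rewrite big_cons big_cons -IH image_ideal_mul.
by rewrite !big_nil image_automE; apply/seteqP.
Qed.

End Automorphism.

(** * Unique factorisation of ideals in a quadratic order *)

Section QuadraticFactorisation.
Variables (R : idomainType) (cj : {rmorphism R -> R}) (w : R) (t n : int).
Hypothesis QR : quadratic_order cj w t n.
Implicit Types (A B C I J L P Q : set R) (s : seq (set R)) (x y z : R).
Let N := bform 1 t n.
Let cjK := quad_cjK QR.

Definition nonzero_ideal I : Prop := exists2 x, x != 0 & I x.

Lemma nonzero_idealS I J : I `<=` J -> nonzero_ideal I -> nonzero_ideal J.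
Proof. by move=> IJ [x x0 Ix]; exists x => //; exact: IJ. Qed.

Lemma nonzero_principal x : x != 0 -> nonzero_ideal (principal_ideal x).
Proof. by exists x => //; exact: mem_principal. Qed.

Lemma nonzero_ideal_mul I J : is_ideal I -> is_ideal J ->
  nonzero_ideal (ideal_mul I J) -> nonzero_ideal I /\ nonzero_ideal J.
Proof.
move=> iI iJ nz; split; first exact: nonzero_idealS (ideal_mul_subl iI) nz.
by rewrite ideal_mulC in nz; exact: nonzero_idealS (ideal_mul_subl iJ) nz.
Qed.

Lemma int_neq0 (g : nat) : (0 < g)%N -> (g%:Z%:~R : R) != 0.
Proof.
move=> g0; apply/eqP; rewrite -[RHS](rmorph0 (intr : int -> R)).
by move/(quad_int_inj QR) => -[]; case: g g0.
Qed.

(** Multiplication by the conjugate of [L] replaces [L] by the principal ideal (g), which cancels in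
    a domain. *)
Lemma ideal_norm_cancel L g I J : ideal_norm cj L g -> is_ideal I -> is_ideal J ->
  ideal_mul L I = ideal_mul L J -> I = J.
Proof.
move=> [g0 Lg] iI iJ e; apply: (principal_cancel (int_neq0 g0)) => //.
by rewrite -Lg (ideal_mulC L) -!ideal_mulA e.
Qed.

Lemma ideal_cancel L I J : is_ideal L -> nonzero_ideal L -> is_ideal I ->
  is_ideal J -> ideal_mul L I = ideal_mul L J -> I = J.
Proof.
move=> iL nzL; have [g Lg] := ideal_norm_ex QR iL nzL.
exact: ideal_norm_cancel Lg.
Qed.

Lemma ideal_normM I J g h : ideal_norm cj I g -> ideal_norm cj J h ->
  ideal_norm cj (ideal_mul I J) (g * h).
Proof.
move=> [g0 Ig] [h0 Jh]; split; first by rewrite muln_gt0 g0.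
rewrite image_ideal_mul PoszM rmorphM principalM -Ig -Jh !ideal_mulA.
by congr ideal_mul; rewrite -!ideal_mulA (ideal_mulC J).
Qed.

Lemma ideal_norm_uniq I g h : ideal_norm cj I g -> ideal_norm cj I h -> g = h.
Proof.
have sub a b : principal_ideal (a%:Z%:~R : R) = principal_ideal (b%:Z%:~R) ->
    (b %| a)%N.
  move=> e; have := mem_principal (a%:Z%:~R : R).
  rewrite e => -[z _ /esym]; rewrite mulrC => /(quad_dvd_int QR).
  by rewrite dvdzE.
move=> [_ e1] [_ e2]; apply/eqP; rewrite eqn_dvd.
by apply/andP; split; apply: sub; rewrite -e1 -e2.
Qed.

Lemma ideal_norm1 I : is_ideal I -> ideal_norm cj I 1 -> I = setT.
Proof.
move=> iI [_ I1]; apply: is_ideal_top => //.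
apply: (ideal_mul_subl iI (J := cj @` I)).
by rewrite I1; exact: mem_principal.
Qed.

(** To contain is to divide: the quotient is g^-1 times conj(J) I, which lies in the ring because
    conj(J) I is contained in conj(J) J = (g). *)
Lemma ideal_dvd I J : is_ideal I -> nonzero_ideal I -> is_ideal J -> I `<=` J ->
  exists2 C, is_ideal C & I = ideal_mul J C.
Proof.
move=> iI nzI iJ IJ.
have [g [g0 Jg]] := ideal_norm_ex QR iJ (nonzero_idealS IJ nzI).
have iJ' : is_ideal (cj @` J) by exact: (is_ideal_image cjK cjK).
have iM : is_ideal (ideal_mul (cj @` J) I) by exact: is_ideal_mul.
pose C := [set c | ideal_mul (cj @` J) I (g%:Z%:~R * c)].
have iC : is_ideal C.
  split=> [|a x y] /=; first by rewrite /C /= mulr0; exact: iM.1.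
  by rewrite /C /= mulrDr mulrCA; exact: iM.2.
exists C => //.
apply: (principal_cancel (int_neq0 g0)) => //; first exact: is_ideal_mul.
rewrite ideal_mulA (ideal_mulC _ J) -(ideal_mulA J) (principal_mulE _ iC).
rewrite -Jg -ideal_mulA; congr ideal_mul; apply/seteqP; split; last first.
  by move=> _ [c Cc <-].
move=> x Mx; have : principal_ideal (g%:Z%:~R : R) x.
  rewrite -Jg ideal_mulC; move: x Mx; exact: ideal_mulS.
by move=> [c _ cE]; exists c; rewrite /C /= mulrC cE.
Qed.

(** Induction on the norm. If x y lies in I but x and y do not, then J = I + (x) is proper, since 1
    = i + r x would give y = i y + r x y in I. Write I = J C; then C is proper too, since otherwise
    I = J would contain x. So both factors have smaller norm. *)
Lemma ideal_factorisation I : is_ideal I -> nonzero_ideal I ->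
  exists s, prime_factorisation I s.
Proof.
move=> iI nzI; have [g Ig] := ideal_norm_ex QR iI nzI.
have [m] := ubnP g; elim: m => // m IH in I iI nzI g Ig *; rewrite ltnS => gm.
have [I1|I1] := pselect (I 1).
  by exists [::]; split=> //; rewrite big_nil (is_ideal_top iI).
have [pI|npI] := pselect (prime_ideal I).
  exists [:: I]; split; first by move=> P; rewrite inE => /eqP ->.
  by rewrite big_cons big_nil ideal_mulT.
have [x [y [Ixy Ix Iy]]] : exists x y, [/\ I (x * y), ~ I x & ~ I y].
  apply: contrapT => no; apply/npI/prime_idealP; split=> // x y Ixy.
  apply: contrapT => /not_orP[Ix Iy]; apply: no; exists x, y; split=> //.
pose J := [set z | exists i r, I i /\ z = i + r * x].
have IJ : I `<=` J by move=> z Iz; exists z, 0; rewrite mul0r addr0.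
have iJ : is_ideal J.
  split=> [|a _ _ [i [r [Ii ->]]] [i' [r' [Ii' ->]]]]; first exact/IJ/iI.1.
  by exists (a * i + i'), (a * r + r'); split; [exact: iI.2 | ring].
have Jx : J x by exists 0, 1; split; [exact: iI.1 | rewrite mul1r add0r].
have J1 : J <> setT.
  move=> JT; have : J 1 by rewrite JT.
  move=> [i [r [Ii e]]]; apply: Iy; rewrite -[y]mul1r e mulrDl -mulrA.
  by apply: is_idealD => //; [exact: is_idealMr | exact: is_idealM].
have [C iC IE] := ideal_dvd iI nzI iJ IJ.
have [nzJ nzC] : nonzero_ideal J /\ nonzero_ideal C.
  by apply: nonzero_ideal_mul => //; rewrite -IE.
have [j Jj] := ideal_norm_ex QR iJ nzJ; have [c Cc] := ideal_norm_ex QR iC nzC.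
have gE : g = (j * c)%N.
  by apply: ideal_norm_uniq Ig _; rewrite IE; exact: ideal_normM.
have j1 : (1 < j)%N.
  case: j Jj {gE} => [[]//|[|//]] /(ideal_norm1 iJ)/J1 [].
have c1 : (1 < c)%N.
  case: c Cc {gE} => [[]//|[|//]] /(ideal_norm1 iC) CT.
  by case: Ix; rewrite IE CT ideal_mulT.
have jm : (j < m)%N by rewrite (leq_trans _ gm) // gE ltn_Pmulr // ltnW.
have cm : (c < m)%N by rewrite (leq_trans _ gm) // gE ltn_Pmull // ltnW.
have [s [sp sE]] := IH J iJ nzJ j Jj jm; have [r [rp rE]] := IH C iC nzC c Cc cm.
exists (s ++ r); split; first by move=> P; rewrite mem_cat => /orP[/sp|/rp].
rewrite -/(ideal_prod _) ideal_prod_cat; last by move=> P /rp /prime_is_ideal.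
by rewrite /ideal_prod sE rE.
Qed.

Lemma prime_ideal_char P : prime_ideal P -> nonzero_ideal P ->
  exists p : nat, prime p /\ forall m : int, P m%:~R <-> (p %| m)%Z.
Proof.
move=> /prime_idealP[iP P1 Pp] [x x0 Px].
have [d dP] : exists d : int, forall a, P a%:~R <-> (d %| a)%Z.
  apply: (@int_subgroup [set a : int | P a%:~R]); first exact: iP.1.
  by move=> a b /= Ia Ib; rewrite rmorphB; exact: is_idealB.
have dP' m : P m%:~R <-> (`|d|%N %| m)%Z by rewrite dP !dvdzE.
exists `|d|%N; split=> //; apply/primeP; split.
  have d0 : d != 0.
    apply: contra_neq (x0) => d0; have [m mE] := quad_norm_ex QR x.
    have /dP : P m%:~R by rewrite -mE; exact: is_idealMr.
    rewrite d0 dvd0z => /eqP m0; apply/eqP; have /eqP := mE.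
    by rewrite m0 mulf_eq0 (quad_cj_eq0 QR) orbb.
  rewrite ltn_neqAle absz_gt0 d0 andbT eq_sym; apply/eqP => d1; apply: P1.
  by apply/(dP' 1); rewrite d1.
move=> e /dvdnP[f dE]; have : P (f%:Z%:~R * e%:Z%:~R).
  by rewrite -rmorphM -PoszM -dE; apply/dP'.
have f0 : (0 < f * e)%N.
  rewrite -dE absz_gt0; apply/eqP => d0; apply: P1.
  have [m mE] := quad_norm_ex QR x.
  have /dP : P m%:~R by rewrite -mE; exact: is_idealMr.
  rewrite d0 dvd0z => /eqP m0; have /eqP := mE.
  by rewrite m0 mulf_eq0 (quad_cj_eq0 QR) orbb (negPf x0).
move: f0; rewrite muln_gt0 => /andP[f0 e0].
move=> /Pp[] /dP'; rewrite dvdzE !absz_nat dE => /dvdnP[k kE].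
  have : (1 * f == k * e * f)%N by apply/eqP; lia.
  rewrite eqn_pmul2r // eq_sym muln_eq1 => /andP[_ /eqP ->].
  by [].
have : (1 * e == k * f * e)%N by apply/eqP; lia.
rewrite eqn_pmul2r // eq_sym muln_eq1 => /andP[_ /eqP ->].
by rewrite mul1n eqxx orbT.
Qed.

(** The integers of Q are those of P, as p generates a maximal ideal of the integers. For z in Q the
    norm is therefore in P, so z or its conjugate is. In the latter case the trace lies in Q, hence
    in P, and z is the trace minus the conjugate. *)
Lemma prime_ideal_maximal P Q : prime_ideal P -> nonzero_ideal P -> is_ideal Q ->
  ~ Q 1 -> P `<=` Q -> P = Q.
Proof.
move=> pP nzP iQ Q1 PQ; have [p [p_pr pE]] := prime_ideal_char pP nzP.
have /prime_idealP[iP P1 Pp] := pP.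
have coprimeQ (m : int) : Q m%:~R -> P m%:~R.
  move=> Qm; apply/pE/negPn/negP => pm; apply: Q1.
  have /coprimezP[[u v] /= uv] : coprimez p m.
    by rewrite coprimezE /= prime_coprime // -[p]/(`|p%:Z|)%N -dvdzE.
  rewrite -[1 : R](rmorph1 (intr : int -> R)) /= -uv rmorphD !rmorphM /=.
  apply: is_idealD => //; apply: is_idealM => //; apply: PQ.
  by apply/pE; rewrite dvdzz.
apply/seteqP; split=> // z Qz.
have [m mE] := quad_norm_ex QR z; have [k kE] := quad_trace_ex QR z.
have : P (z * cj z).
  by rewrite mE; apply: coprimeQ; rewrite -mE; exact: is_idealMr.
case/Pp => // Pz; have -> : z = k%:~R - cj z by rewrite -kE addrK.
apply: is_idealB => //; apply: coprimeQ; rewrite -kE.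
by apply: is_idealD => //; exact: PQ.
Qed.

Lemma prime_factorisation_uniq I s s' : nonzero_ideal I ->
  prime_factorisation I s -> prime_factorisation I s' -> perm_eq s s'.
Proof.
elim: s => [|P s IH] in I s' *.
  move=> _ [_ <-]; rewrite big_nil; case: s' => // Q s' [s'p s'E].
  have pQ := s'p _ (mem_head _ _); have /prime_idealP[iQ Q1 _] := pQ.
  case: Q1; rewrite big_cons in s'E.
  apply: (ideal_mul_subl iQ (J := ideal_prod s')).
  by have -> : ideal_mul Q (ideal_prod s') = setT := s'E.
move=> nzI [sp sE] [s'p s'E]; have pP := sp _ (mem_head _ _).
have iP := prime_is_ideal pP.
have s_ideal L : L \in s -> is_ideal L.
  by move=> Ls; apply/prime_is_ideal/sp; rewrite inE Ls orbT.
have s'_ideal L : L \in s' -> is_ideal L by move=> /s'p /prime_is_ideal.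
rewrite big_cons in sE.
have [nzP nzs] : nonzero_ideal P /\ nonzero_ideal (ideal_prod s).
  apply: nonzero_ideal_mul => //; first exact: is_ideal_prod.
  by rewrite /ideal_prod sE.
have [Q Qs' QP] : exists2 Q, Q \in s' & Q `<=` P.
  apply: prime_ideal_prod => //; rewrite /ideal_prod s'E -sE.
  exact: ideal_mul_subl.
have QE : Q = P.
  have /prime_idealP[_ P1 _] := pP.
  apply: prime_ideal_maximal => //; first exact: s'p.
  by apply: nonzero_idealS nzI; rewrite -s'E; exact: ideal_prod_sub.
rewrite QE in Qs'.
have s1 : ideal_prod s = ideal_prod (rem P s').
  apply: (ideal_cancel iP nzP); [exact: is_ideal_prod | |].
    by apply: is_ideal_prod => L /mem_rem; exact: s'_ideal.
  by rewrite -ideal_prod_rem // /ideal_prod sE s'E.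
rewrite perm_sym (perm_trans (perm_to_rem Qs')) // perm_cons perm_sym.
apply: IH nzs _ _; split=> //.
  by move=> L Ls; apply: sp; rewrite inE Ls orbT.
by move=> L /mem_rem /s'p.
Qed.

End QuadraticFactorisation.

(** * Valuations and k-free elements *)

Section Valuation.
Variables (R : idomainType) (cj : {rmorphism R -> R}) (w : R) (t n : int).
Hypothesis QR : quadratic_order cj w t n.
Implicit Types (A B C I J L P Q : set R) (s : seq (set R)) (x y z : R).
Let N := bform 1 t n.
Let D := t ^+ 2 - 4 * n.
Let cjK := quad_cjK QR.

(** Existence of a factorisation rules out the default of [xget], so the list behind [valuation] is
    a genuine one. *)
Lemma valuation_factorisation x : x != 0 -> exists s,
  prime_factorisation (principal_ideal x) s /\
  forall P, valuation P x = count_mem P s.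
Proof.
move=> x0; pose F := [set s | prime_factorisation (principal_ideal x) s].
have [s0 s0P] :=
  ideal_factorisation QR (is_ideal_principal x) (nonzero_principal x0).
by exists (xget [::] F); split=> //; exact: (@xgetI _ _ F s0).
Qed.

Lemma valuationE x s P : x != 0 -> prime_factorisation (principal_ideal x) s ->
  valuation P x = count_mem P s.
Proof.
move=> x0 sx; have [s' [s'x ->]] := valuation_factorisation x0.
by apply/permP/(prime_factorisation_uniq QR (nonzero_principal x0)).
Qed.

Lemma valuationM P x y : x != 0 -> y != 0 ->
  valuation P (x * y) = (valuation P x + valuation P y)%N.
Proof.
move=> x0 y0; have [s [[sp sE] ->]] := valuation_factorisation x0.
have [r [[rp rE] ->]] := valuation_factorisation y0.
rewrite (@valuationE _ (s ++ r)) ?mulf_neq0 ?count_cat //; split.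
  by move=> Q; rewrite mem_cat => /orP[/sp|/rp].
rewrite -/(ideal_prod _) ideal_prod_cat; last by move=> Q /rp /prime_is_ideal.
by rewrite /ideal_prod sE rE principalM.
Qed.

Lemma valuation_gt0 P x : prime_ideal P -> x != 0 ->
  (0 < valuation P x)%N <-> P x.
Proof.
move=> pP x0; have [s [[sp sE] ->]] := valuation_factorisation x0.
have s_ideal L : L \in s -> is_ideal L by move=> /sp /prime_is_ideal.
rewrite -has_count has_pred1; split=> [Ps|Px].
  apply: (ideal_prod_sub s_ideal Ps).
  by rewrite /ideal_prod sE; exact: mem_principal.
have [Q Qs QP] : exists2 Q, Q \in s & Q `<=` P.
  apply: prime_ideal_prod => //; rewrite /ideal_prod sE => _ [a _ <-].
  exact: is_idealM (prime_is_ideal pP) Px.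
suff <- : Q = P by [].
have /prime_idealP[iP P1 _] := pP.
apply: (prime_ideal_maximal QR) => //; first exact: sp.
apply: nonzero_idealS (ideal_prod_sub s_ideal Qs) _.
by rewrite /ideal_prod sE; exact: nonzero_principal.
Qed.

Lemma valuation_eq0 P x : prime_ideal P -> x != 0 -> ~ P x -> valuation P x = 0%N.
Proof.
move=> pP x0 Px; case E: (valuation P x) => [//|v]; case: Px.
by apply/valuation_gt0; rewrite ?E.
Qed.

Lemma valuationX P x m : prime_ideal P -> x != 0 ->
  valuation P (x ^+ m) = (m * valuation P x)%N.
Proof.
move=> pP x0; elim: m => [|m IH]; last by rewrite exprS valuationM ?expf_neq0 ?IH.
rewrite expr0 valuation_eq0 ?oner_neq0 //.
by have /prime_idealP[] := pP.
Qed.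

Lemma valuation_image (f g : {rmorphism R -> R}) P x :
    cancel f g -> cancel g f -> x != 0 ->
  valuation (f @` P) (f x) = valuation P x.
Proof.
move=> fK gK x0; have [s [[sp sE] ->]] := valuation_factorisation x0.
rewrite (@valuationE _ [seq f @` Q | Q <- s]); last first.
- split; first by move=> _ /mapP[Q /sp pQ ->]; exact: prime_ideal_image.
  by rewrite -/(ideal_prod _) -(image_ideal_prod fK gK) /ideal_prod sE
    (image_principal gK).
- by apply: contra_neq x0 => fx0; rewrite -[x]fK fx0 rmorph0.
rewrite count_map; apply: eq_count => Q /=.
exact: inj_eq (image_autom_inj fK) _ _.
Qed.

Lemma kfree_autom (f g : {rmorphism R -> R}) k x :
  cancel f g -> cancel g f -> kfree k x -> kfree k (f x).
Proof.
move=> fK gK [x0 xk]; split.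
  by apply: contra_neq x0 => fx0; rewrite -[x]fK fx0 rmorph0.
(* Every prime ideal is the image under [f] of a prime ideal, so the bound at [f x] is read off at
   [x]. *)
move=> P pP; have -> : P = f @` (g @` P).
  apply/seteqP; split=> [y Py|_ [_ [z Pz <-] <-]]; last by rewrite gK.
  by exists (g y); [exists y | exact: gK].
by rewrite (valuation_image _ fK gK) //; apply/xk/(prime_ideal_image gK fK).
Qed.

Lemma kfree_unit k e x : e \is a GRing.unit -> kfree k x -> kfree k (e * x).
Proof.
move=> ue [x0 xk]; have e0 : e != 0 by apply: contraTneq ue => ->; rewrite unitr0.
split=> [|P pP]; first by rewrite mulf_neq0.
rewrite valuationM // valuation_eq0 ?add0n //; first exact: xk.
have /prime_idealP[iP P1 _] := pP; move=> Pe; apply: P1.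
by rewrite -(mulVr ue); exact: is_idealM.
Qed.

Lemma kfreeS k l x : (k <= l)%N -> kfree k x -> kfree l x.
Proof. by move=> kl [x0 xk]; split=> // P /xk /leq_trans; apply. Qed.

Lemma intr_neq0 (m : int) : m != 0 -> (m%:~R : R) != 0.
Proof.
by apply: contra_neq => m0; apply: (quad_int_inj QR); rewrite m0 rmorph0.
Qed.

Lemma prime_neq0 (p : nat) : prime p -> (p%:Z%:~R : R) != 0.
Proof. by move=> /prime_gt0; exact: int_neq0 QR _. Qed.

Lemma prime_ideal_over (p : nat) : prime p ->
  exists2 P : set R, prime_ideal P & P p%:Z%:~R.
Proof.
move=> p_pr; have p0 := prime_neq0 p_pr.
have [[|P s] [[sp sE] _]] := valuation_factorisation p0; last first.
  exists P; first by apply: sp; rewrite mem_head.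
  have : ideal_prod (P :: s) `<=` P.
    by apply: ideal_prod_sub; rewrite ?mem_head // => L /sp /prime_is_ideal.
  by rewrite /ideal_prod sE; apply; exact: mem_principal.
have : principal_ideal (p%:Z%:~R : R) 1 by rewrite -sE big_nil.
move=> [y _ /esym]; rewrite mulrC -[1](rmorph1 (intr : int -> R)).
move=> /(quad_dvd_int QR); rewrite dvdzE /= dvdn1 => /eqP p1.
by rewrite p1 in p_pr.
Qed.

Lemma prime_ideal_int P (p : nat) : prime_ideal P -> prime p -> P p%:Z%:~R ->
  forall m : int, P m%:~R <-> (p %| m)%Z.
Proof.
move=> pP p_pr Pp; have nzP : nonzero_ideal P.
  by exists p%:Z%:~R => //; exact: prime_neq0.
have [q [q_pr qE]] := prime_ideal_char QR pP nzP.
suff -> : p = q by [].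
by move/qE: Pp; rewrite dvdzE /= dvdn_prime2 // => /eqP.
Qed.

(* If (p) = P^2 J then every z in PJ satisfies p | z^2, hence p divides the
   trace and the norm of z, hence D times the square of its w-coordinate. *)
Lemma valuation_unramified P (p : nat) : prime_ideal P -> prime p ->
  ~~ (p %| D)%Z -> (valuation P (p%:Z%:~R : R) <= 1)%N.
Proof.
move=> pP p_pr pD; have p0 := prime_neq0 p_pr; rewrite leqNgt; apply/negP => v2.
have [s [[sp sE] vE]] := valuation_factorisation p0.
rewrite vE in v2.
have Ps : P \in s by rewrite -has_pred1 has_count (leq_trans _ v2).
have Prs : P \in rem P s.
  move/permP: (perm_to_rem Ps) => /(_ (pred1 P)) /= e.
  by move: v2; rewrite e eqxx add1n ltnS -has_count has_pred1.
pose J := ideal_prod (rem P (rem P s)).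
have iP := prime_is_ideal pP.
have iJ : is_ideal J.
  by apply: is_ideal_prod => L /mem_rem /mem_rem /sp /prime_is_ideal.
have pE : principal_ideal (p%:Z%:~R : R) = ideal_mul P (ideal_mul P J).
  by rewrite -sE -/(ideal_prod _) (ideal_prod_rem Ps) (ideal_prod_rem Prs).
pose C := ideal_mul P J; have iC : is_ideal C by exact: is_ideal_mul.
have CC : ideal_mul C C `<=` principal_ideal (p%:Z%:~R : R).
  rewrite pE {1}/C -ideal_mulA; apply: ideal_mulS => //.
  by rewrite ideal_mulC; exact: ideal_mul_subl.
(* Since (p) = P C lies in C, this inclusion would give C = (p) and (p) = P (p), and cancelling p
   would make P the whole ring. *)
suff Cp : C `<=` principal_ideal (p%:Z%:~R : R).
  have CE : C = principal_ideal (p%:Z%:~R : R).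
    by apply/seteqP; split=> //; rewrite pE ideal_mulC; exact: ideal_mul_subl.
  have /prime_idealP[_ P1 _] := pP; apply: P1.
  suff -> : P = setT by [].
  apply: (principal_cancel p0) => //.
  rewrite -{1}CE ideal_mulC /C -pE ideal_mulT //; exact: is_ideal_principal.
have ip := is_ideal_principal (p%:Z%:~R : R).
move=> z Cz; have [a [b zE]] := quad_eltP QR z.
have p_int m : principal_ideal (p%:Z%:~R : R) m%:~R -> (p %| m)%Z.
  by move=> [y _ /esym]; rewrite mulrC; exact: quad_dvd_int QR _ _ _.
have p_elt c d : (p %| c)%Z -> (p %| d)%Z ->
    principal_ideal (p%:Z%:~R : R) (quad_elt w c d).
  move=> /dvdzP[c' ->] /dvdzP[d' ->]; exists (quad_elt w c' d') => //.
  by rewrite mulrC (quad_intM w); congr quad_elt; rewrite mulrC.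
have zz : principal_ideal (p%:Z%:~R : R) (z * z) by apply/CC/mem_ideal_mul.
have pN : (p %| N a b)%Z.
  suff : (p %| N a b * N a b)%Z by rewrite (Euclid_dvdzM p_pr) orbb.
  have [y _ yE] := zz.
  apply: (@quad_dvd_int _ _ _ _ _ QR p%:Z _ (y * cj (z * z))).
  rewrite rmorphM /= -!(quad_normE QR) -zE [RHS]mulrA [_ * y]mulrC yE rmorphM /=.
  by ring.
have [m mE] := quad_trace_ex QR z.
have mE' : m = 2 * a + t * b.
  apply: (quad_int_inj QR); rewrite -mE zE (quad_cjE QR) -(quad_int w) /quad_elt.
  by rewrite !(rmorphD, rmorphN, rmorphM) /=; ring.
(* As m z = z^2 + N(z) lies in (p), a trace [m] prime to p puts z in (p) at once by Bezout. *)
have [pm|pm] := boolP (p %| m)%Z; last first.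
  have mz : principal_ideal (p%:Z%:~R : R) (m%:~R * z).
    rewrite -mE mulrDl [cj z * z]mulrC zE (quad_normE QR) -zE.
    apply: is_idealD => //; rewrite -[X in _ X](quad_int w).
    by apply: p_elt; rewrite ?dvdz0.
  have /coprimezP[[u v] /= uv] : coprimez p m.
    by rewrite coprimezE /= prime_coprime // -[p]/(`|p%:Z|)%N -dvdzE.
  have -> : z = u%:~R * z * p%:~R + v%:~R * (m%:~R * z).
    by rewrite mulrAC mulrA -mulrDl -!rmorphM -rmorphD uv mul1r.
  apply: is_idealD => //; apply: is_idealM => //; exact: mem_principal.
have pb : (p %| b)%Z.
  have : (p %| D * (b * b))%Z.
    have -> : D * (b * b) = m * m - 4 * N a b by rewrite mE' /D /N /bform; ring.
    by apply: rpredB; [exact: dvdz_mulr | exact: dvdz_mull].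
  by rewrite !(Euclid_dvdzM p_pr) (negPf pD) orbb.
by rewrite zE; apply: p_elt => //; exact: bform_dvdl pN pb.
Qed.

(** If P^2 divided x, the norm of x would have valuation at least 2 at P. But that norm is p m with
    p prime to m, and p is unramified, so the valuation is at most 1. *)
Lemma kfree_squarefree_norm a b k : (2 <= k)%N -> coprimez (N a b) D ->
    (forall p : nat, prime p -> ~~ (p%:Z ^+ 2 %| N a b)%Z) ->
  kfree k (quad_elt w a b).
Proof.
move=> k2 cop sqf; apply: (kfreeS k2); set x := quad_elt w a b.
have N0 : N a b != 0 by apply/eqP => N0; have := sqf 2 isT; rewrite N0 dvdz0.
have xE := quad_normE QR a b; rewrite -/x -/N in xE.
have xx0 : x * cj x != 0 by rewrite xE; exact: intr_neq0.
have /norP[x0 cx0] : ~~ ((x == 0) || (cj x == 0)) by rewrite -mulf_eq0.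
split=> // P pP; rewrite ltnS leqNgt; apply/negP => v2.
have Px : P x by apply/(valuation_gt0 pP x0); exact: leq_trans v2.
have iP := prime_is_ideal pP.
have [p [p_pr pE]] := prime_ideal_char QR pP (ex_intro2 _ _ x x0 Px).
have pN : (p %| N a b)%Z by apply/pE; rewrite -xE; exact: is_idealMr.
have pD : ~~ (p %| D)%Z.
  apply/negP => pD; have := dvdz_gcd p (N a b) D; rewrite pN pD /= (eqP cop).
  by rewrite dvdzE /= dvdn1; apply/negP; case: eqP p_pr => // ->.
have /dvdzP[m mE] := pN.
have m0 : m != 0 by apply: contra_neq N0 => m0; rewrite mE m0 mul0r.
have pm : ~ P m%:~R.
  move=> /pE pm; have := sqf _ p_pr.
  by rewrite mE expr2 dvdz_mul.
have : (2 <= valuation P (x * cj x))%N by rewrite valuationM // ltn_addr.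
rewrite xE mE rmorphM /= valuationM ?intr_neq0 ?prime_neq0 //; last first.
  by case: p p_pr {pE pN pD mE pm}.
rewrite (valuation_eq0 pP) ?intr_neq0 // add0n leqNgt ltnS.
by rewrite valuation_unramified.
Qed.

(** At a prime above p the element x has valuation 0 and p^(k-1) at most k - 1, p being unramified.
    At the other primes p^(k-1) contributes nothing. *)
Lemma kfree_prime_exp (p : nat) k a b : prime p -> ~~ (p %| D)%Z ->
    ~~ (p %| N a b)%Z -> kfree k (quad_elt w a b) ->
  kfree k ((p%:Z%:~R) ^+ k.-1 * quad_elt w a b).
Proof.
move=> p_pr pD pN [x0 xk]; have p0 := prime_neq0 p_pr.
split=> [|P pP]; first by rewrite mulf_neq0 ?expf_neq0.
rewrite valuationM ?expf_neq0 // valuationX //.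
have [Pp|Pp] := pselect (P p%:Z%:~R); last first.
  by rewrite (valuation_eq0 pP p0 Pp) muln0 add0n; exact: xk.
have k0 : (0 < k)%N by exact: leq_ltn_trans (xk P pP).
rewrite (valuation_eq0 pP x0) ?addn0; last first.
  move=> Px; case/negP: pN; apply/(prime_ideal_int pP p_pr Pp).
  by rewrite -(quad_normE QR); exact: is_idealMr (prime_is_ideal pP) Px.
rewrite -[X in (_ < X)%N](prednK k0) ltnS -[leqRHS]muln1 leq_mul2l.
by rewrite valuation_unramified ?orbT.
Qed.

(** If p divides the norm of x, a prime P above p contains x or its conjugate, so P or its conjugate
    contains x. There p^(k-1) x has valuation at least (k - 1) + 1. *)
Lemma kfree_prime_exp_norm (p : nat) k a b : prime p -> (0 < k)%N ->
  kfree k ((p%:Z%:~R) ^+ k.-1 * quad_elt w a b) -> ~~ (p %| N a b)%Z.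
Proof.
move=> p_pr k0 [px0 xk]; have p0 := prime_neq0 p_pr; apply/negP => pN.
set x := quad_elt w a b in px0 xk.
have x0 : x != 0 by apply: contra_neq px0 => ->; rewrite mulr0.
have noP Q : prime_ideal Q -> Q p%:Z%:~R -> ~ Q x.
  move=> pQ Qp Qx; have := xk Q pQ.
  rewrite valuationM ?expf_neq0 // valuationX //.
  apply/negP; rewrite -leqNgt -{1}(prednK k0) -addn1 leq_add //.
    by rewrite leq_pmulr //; apply/(valuation_gt0 pQ p0).
  exact/(valuation_gt0 pQ x0).
have [P pP Pp] := prime_ideal_over p_pr.
have : P (x * cj x).
  by rewrite (quad_normE QR); apply/(prime_ideal_int pP p_pr Pp).
have /prime_idealP[_ _ Pm] := pP.
case/Pm => [|Px]; first exact: noP.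
apply: (noP (cj @` P)).
- exact: (prime_ideal_image cjK cjK).
- by exists p%:Z%:~R; rewrite ?rmorph_int.
- by exists (cj x); rewrite ?cjK.
Qed.

(** At a prime above p both x and its conjugate have valuation at most k - 1, so their product
    cannot reach 2 k. *)
Lemma kfree_norm_exp (p : nat) k a b : prime p ->
  kfree k (quad_elt w a b) -> ~~ (p%:Z ^+ (2 * k) %| N a b)%Z.
Proof.
move=> p_pr xk; have p0 := prime_neq0 p_pr; apply/negP => /dvdzP[m mE].
have [P pP Pp] := prime_ideal_over p_pr.
have [cx0 /(_ P pP) vcx] := kfree_autom cjK cjK xk.
case: xk => x0 /(_ P pP) vx.
have : valuation P (quad_elt w a b * cj (quad_elt w a b))
    = valuation P (N a b)%:~R.
  by rewrite (quad_normE QR).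
have m0 : m != 0.
  have : quad_elt w a b * cj (quad_elt w a b) != 0 by rewrite mulf_neq0.
  rewrite (quad_normE QR) -/N mE; apply: contra_neq => ->.
  by rewrite mul0r.
rewrite mE rmorphM rmorphXn /= !valuationM ?expf_neq0 ?intr_neq0 //; last first.
  by case: p p_pr {mE Pp p0}.
rewrite valuationX //.
have : (0 < valuation P (p%:Z%:~R : R))%N by apply/(valuation_gt0 pP p0).
by move/(leq_pmulr (2 * k)); move: vx vcx; do 4!move: (valuation P _); lia.
Qed.

End Valuation.

(** * Integers of a quadratic field *)

Section GalInt.
Variables (K : fieldExtType rat) (s : 'AEnd(K)).

Lemma gal_int_is_zmod_morphism : zmod_morphism (gal_int s).
Proof. by move=> x y; apply: val_inj; rewrite /= rmorphB. Qed.

Lemma gal_int_is_monoid_morphism : monoid_morphism (gal_int s).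
Proof.
by split=> [|x y]; apply: val_inj; rewrite /= ?rmorph1 ?rmorphM.
Qed.

HB.instance Definition _ := GRing.isZmodMorphism.Build (intRing K) (intRing K)
  (gal_int s) gal_int_is_zmod_morphism.
HB.instance Definition _ := GRing.isMonoidMorphism.Build (intRing K) (intRing K)
  (gal_int s) gal_int_is_monoid_morphism.

End GalInt.

Section Integers.
Variable K : fieldExtType rat.

Lemma mem1vP (x : K) :
  reflect (exists a, x = (in_alg K : {rmorphism rat -> K}) a) (x \in 1%VS).
Proof. exact: vlineP. Qed.

Lemma ringInt_quadratic (x : K) (u v : int) :
  x ^+ 2 - u%:~R * x + v%:~R = 0 -> x \in ringInt K.
Proof.
move=> xE; apply/asboolP; exists ('X^2 - u *: 'X + v%:P).
  rewrite monicE -addrA lead_coefDl ?lead_coefXn // size_polyXn.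
  rewrite (leq_ltn_trans (size_polyD _ _)) // gtn_max size_polyN.
  rewrite (leq_ltn_trans (size_scale_leq _ _)) ?size_polyX //=.
  by rewrite (leq_ltn_trans (size_polyC_leq1 _)).
rewrite rootE !rmorphD rmorphN /= map_polyXn map_polyZ map_polyX map_polyC /=.
by rewrite !hornerE xE.
Qed.

Lemma ringInt_int (m : int) : (m%:~R : K) \in ringInt K.
Proof.
by apply: (@ringInt_quadratic _ (2 * m) (m ^+ 2)); rewrite !rmorphM /=; ring.
Qed.

(** The root is transported to [algC], where a rational algebraic integer is known to be an
    integer. *)
Lemma ringInt_rat (a : rat) :
  (in_alg K : {rmorphism rat -> K}) a \in ringInt K -> exists m : int, a = m%:~R.
Proof.
move=> /asboolP[p pm pa].
have pa' : root (map_poly (intr : int -> algC) p) (ratr a).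
  have {}pa : root (map_poly (intr : int -> rat) p) a.
    rewrite -(fmorph_root (in_alg K)) -map_poly_comp.
    by rewrite (eq_map_poly (g := intr)) // => z; exact: (rmorph_int (in_alg K)).
  rewrite -(fmorph_root (ratr : rat -> algC)) -map_poly_comp in pa.
  by move: pa; rewrite (eq_map_poly (g := intr)) // => z /=; rewrite ratr_int.
have /intrP[m mE] : (ratr a : algC) \is a Num.int.
  apply: Cint_rat_Aint; first exact: Crat_rat.
  apply: root_monic_Aint pa' _ _; first exact: monic_map.
  by apply/polyOverP => i; rewrite coef_map /= intr_int.
exists m; apply: (fmorph_inj (ratr : {rmorphism rat -> algC})) => /=.
by rewrite mE ratr_int.
Qed.

End Integers.

(** * Square roots and conjugation in a quadratic field *)

Section QuadraticField.
Variable K : fieldExtType rat.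
Hypothesis hK : \dim {:K} = 2%N.
Notation inQ := (in_alg K : {rmorphism rat -> K}).

Lemma adjoin_full (th : K) : th \notin 1%VS ->
  <<1; th>>%VS = fullv /\ adjoin_degree 1 th = 2%N.
Proof.
move=> th1; have d1 : \dim (1%AS : {vspace K}) = 1%N by rewrite dimv1.
have d2 : (2 <= \dim <<1; th>>)%N.
  rewrite ltnNge; apply/negP => d; case/negP: th1.
  have /eqP -> : 1%VS == <<1; th>>%VS.
    by rewrite eqEdim subv_adjoin dimv1.
  exact: memv_adjoin.
have full : <<1; th>>%VS = fullv by apply/eqP; rewrite eqEdim subvf hK.
split=> //; have := dim_Fadjoin 1 th.
by rewrite d1 muln1 full hK => <-.
Qed.

Lemma adjoin_coord (th x : K) : th \notin 1%VS ->
  exists a b : rat, x = inQ a + inQ b * th.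
Proof.
move=> th1; have [full deg] := adjoin_full th1.
have xth : x \in <<1; th>>%VS by rewrite full memvf.
have := Fadjoin_polyOver 1 th x; set p := Fadjoin_poly _ _ _ => /polyOverP pP.
have /mem1vP[a aE] := pP 0%N; have /mem1vP[b bE] := pP 1%N.
exists a, b; rewrite -[LHS](Fadjoin_poly_eq xth) -/p (@horner_coef_wide _ 2).
  by rewrite !big_ord_recl big_ord0 /= aE bE expr0 expr1 mulr1 addr0.
by rewrite -deg; exact: size_Fadjoin_poly.
Qed.

Lemma adjoin_free (th : K) (a b : rat) : th \notin 1%VS ->
  inQ a + inQ b * th = 0 -> a = 0 /\ b = 0.
Proof.
move=> th1 e; have b0 : b = 0.
  apply/eqP/negPn/negP => b0; case/negP: th1; apply/mem1vP; exists (- a / b).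
  have b0' : inQ b != 0 by rewrite fmorph_eq0.
  apply: (mulfI b0'); rewrite -rmorphM mulrCA divff // mulr1 rmorphN /=.
  by apply/eqP; rewrite -addr_eq0 addrC e.
split=> //; move: e; rewrite b0 rmorph0 mul0r addr0 => /eqP.
by rewrite fmorph_eq0 => /eqP.
Qed.

Lemma exists_sqrt : exists (th : K) (d : int), th \notin 1%VS /\ th * th = d%:~R.
Proof.
have /subvPn[th0 _ th0n] : ~~ (fullv <= (1%VS : {vspace K}))%VS.
  by apply/negP => /dimvS; rewrite hK dimv1.
have [a [b E]] := adjoin_coord (th0 * th0) th0n.
(* Completing the square in th0^2 = a + b th0 gives th^2 = r. Scaling by the denominator of [r] then
   makes the square an integer. *)
pose r := a + b ^+ 2 / 4; pose th := th0 - inQ (b / 2).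
have thE : th * th = inQ r.
  have -> : r = a + b / 2 * (b / 2) by rewrite /r; field.
  rewrite rmorphD rmorphM /= /th.
  transitivity (th0 * th0 - (inQ (b / 2) + inQ (b / 2)) * th0
     + inQ (b / 2) * inQ (b / 2)); first by ring.
  rewrite -rmorphD E; have -> : b / 2 + b / 2 = b by field.
  by rewrite addrK.
have denE : (denq r)%:~R * r = (numq r)%:~R.
  by rewrite numqE mulrC.
exists ((denq r)%:~R * th), (denq r * numq r); split; last first.
  have -> : (denq r * numq r)%:~R = inQ ((denq r)%:~R * ((denq r)%:~R * r)).
    by rewrite denE -rmorphM rmorph_int.
  by rewrite mulrACA thE !(rmorphM inQ) !(rmorph_int inQ) mulrA.
apply/negP => /mem1vP[q qE]; case/negP: th0n; apply/mem1vP.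
exists (q / (denq r)%:~R + b / 2).
have den0 : (denq r)%:~R != 0 :> rat by rewrite intr_eq0 denq_neq0.
have den0' : inQ (denq r)%:~R != 0 by rewrite fmorph_eq0.
have -> : th0 = th + inQ (b / 2) by rewrite /th subrK.
have -> : th = inQ (q / (denq r)%:~R).
  apply: (mulfI den0'); rewrite -rmorphM mulrCA divff // mulr1.
  by rewrite (rmorph_int inQ).
by rewrite -rmorphD.
Qed.

Lemma ringInt_sqrt (th : K) (d : int) : th * th = d%:~R -> th \in ringInt K.
Proof.
move=> thE; apply: (@ringInt_quadratic _ _ 0 (- d)).
by rewrite mul0r subr0 rmorphN /= -thE expr2 subrr.
Qed.

(** The minimal polynomial of [th] is X^2 - th^2, with - th as its other root, so the identity of
    the base field extends. *)
Lemma exists_conj (th : K) (d : int) : th \notin 1%VS -> th * th = d%:~R ->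
  exists s : 'AEnd(K), s th = - th.
Proof.
move=> th1 thE; have [full deg] := adjoin_full th1.
have thd : th ^+ 2 \in 1%VS.
  by apply/mem1vP; exists d%:~R; rewrite rmorph_int expr2.
have minE : minPoly 1 th = 'X^2 - (th ^+ 2)%:P.
  by rewrite /minPoly deg Fadjoin_polyC.
have hom1 : kHom 1 1 (\1%VF : 'End(K)) by exact: kHom1.
have rt : root (map_poly (\1%VF : 'End(K)) (minPoly 1 th)) (- th).
  rewrite (eq_map_poly (g := idfun)) ?map_poly_id //; last first.
    by move=> x; rewrite lfunE.
  by rewrite minE rootE !hornerE sqrrN subrr.
have := kHomExtendP (subvv _) hom1 rt; rewrite full k1HomE => homs.
by exists (AHom homs) => /=; exact: kHomExtend_val hom1 rt.
Qed.

End QuadraticField.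

(** * An integral basis of the ring of integers *)

Section QuadraticIntegers.
Variable K : fieldExtType rat.
Hypothesis hK : \dim {:K} = 2%N.
Notation inQ := (in_alg K : {rmorphism rat -> K}).

Lemma ringInt_gal (s : 'AEnd(K)) (x : K) : x \in ringInt K -> s x \in ringInt K.
Proof. by move=> hx; exact: (gal_int_subproof s (IntRing hx)). Qed.

(* The coordinate of an integer along th lies in the group generated by
   1 / (2 d), so the coordinates of integers form a cyclic group; w is an
   integer with generating coordinate. *)
Lemma exists_quadratic_order : exists (s : 'AEnd(K)) (w : intRing K) (t n : int),
  quadratic_order (gal_int s) w t n.
Proof.
have [th [d [th1 thE]]] := exists_sqrt hK; have [s sth] := exists_conj hK th1 thE.
have sQ a : s (inQ a) = inQ a by rewrite /= linearZ /= rmorph1.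
have sE a b : s (inQ a + inQ b * th) = inQ a - inQ b * th.
  have -> : s (inQ a + inQ b * th) = s (inQ a) + s (inQ b) * s th.
    by rewrite rmorphD rmorphM.
  by rewrite !sQ sth mulrN.
have th0 : th != 0 by apply: contraNneq th1 => ->; exact: mem0v.
have d0 : d%:~R != 0 :> rat.
  rewrite -(fmorph_eq0 inQ) (rmorph_int inQ) -thE mulf_eq0 orbb //.
have d20 : 2 * d%:~R != 0 :> rat by rewrite mulf_neq0.
have th_int := ringInt_sqrt thE.
(* For x = a + b th, the integer (x - s x) th = 2 b d is rational, hence in Z. *)
have coefP a b : inQ a + inQ b * th \in ringInt K ->
    exists c : int, b = c%:~R / (2 * d%:~R).
  set x := (X in X \in _) => hx; have hsx := ringInt_gal s hx.
  have : inQ (b * (2 * d%:~R)) \in ringInt K.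
    have -> : inQ (b * (2 * d%:~R)) = (x - s x) * th.
      rewrite /x sE.
      rewrite (rmorphM inQ) (rmorphM inQ) (rmorph_nat inQ) (rmorph_int inQ) -thE.
      by ring.
    by rewrite rpredM ?rpredB.
  by move=> /ringInt_rat[c cE]; exists c; rewrite -cE mulfK.
have [d1 d1P] : exists d1 : int, forall c : int,
    (exists a, inQ a + inQ (c%:~R / (2 * d%:~R)) * th \in ringInt K) <->
    (d1 %| c)%Z.
  apply: (@int_subgroup [set c : int | exists a,
    inQ a + inQ (c%:~R / (2 * d%:~R)) * th \in ringInt K]).
    by exists 0; rewrite mul0r !(rmorph0 inQ) mul0r addr0 rpred0.
  move=> c c' [a ha] [a' ha']; exists (a - a'); rewrite intrB mulrBl.
  rewrite !(rmorphB inQ) mulrBl addrACA -opprD; exact: rpredB ha ha'.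
(* The integer [th] itself has coordinate 1 = 2 d / (2 d), so 2 d belongs to the group. *)
have d10 : d1 != 0.
  apply: contra_neq d0 => d10; have /d1P : exists a,
      inQ a + inQ ((2 * d)%:~R / (2 * d%:~R)) * th \in ringInt K.
    have -> : (2 * d)%:~R = 2 * d%:~R :> rat by rewrite intrM.
    exists 0; rewrite (rmorph0 inQ) add0r divff // (rmorph1 inQ).
    by rewrite mul1r.
  by rewrite d10 dvd0z mulf_eq0 /= => /eqP ->.
have [a1 hw] := (d1P d1).2 (dvdzz _).
have [b1 b1E] : exists b1 : rat, b1 = d1%:~R / (2 * d%:~R) by eexists.
rewrite -b1E in hw; set w0 := _ + _ in hw.
have b10 : b1 != 0 by rewrite b1E mulf_neq0 ?invr_eq0 ?intr_eq0.
have sw0 : s w0 = inQ a1 - inQ b1 * th.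
  exact: sE.
have hsw := ringInt_gal s hw.
have [t tE] : exists t : int, w0 + s w0 = t%:~R.
  have E : w0 + s w0 = inQ (a1 + a1) by rewrite sw0 (rmorphD inQ) /w0; ring.
  have /ringInt_rat[t tE] : inQ (a1 + a1) \in ringInt K by rewrite -E rpredD.
  by exists t; rewrite E tE (rmorph_int inQ).
have [n nE] : exists n : int, w0 * s w0 = n%:~R.
  have E : w0 * s w0 = inQ (a1 * a1 - b1 * b1 * d%:~R).
    by rewrite sw0 rmorphB !rmorphM (rmorph_int inQ) -thE /w0; ring.
  have /ringInt_rat[n nE] : inQ (a1 * a1 - b1 * b1 * d%:~R) \in ringInt K.
    by rewrite -E rpredM.
  by exists n; rewrite E nE (rmorph_int inQ).
pose w : intRing K := IntRing hw.
have vint (m : int) : val (m%:~R : intRing K) = m%:~R by exact: rmorph_int.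
have sqr : w * w = t%:~R * w - n%:~R.
  apply: val_inj; rewrite rmorphB !rmorphM /= !vint -tE -nE /=; ring.
have free (a b : int) : a%:~R + b%:~R * w = 0 -> a = 0 /\ b = 0.
  move=> /(congr1 val); rewrite rmorphD rmorphM /= !vint /= => e.
  have e' : inQ (a%:~R + b%:~R * a1) + inQ (b%:~R * b1) * th = 0.
    rewrite (rmorphD inQ) !(rmorphM inQ) !(rmorph_int inQ) -[RHS]e /w0; ring.
  have [] := adjoin_free th1 e'.
  move=> + /eqP; rewrite mulf_eq0 (negPf b10) orbF intr_eq0 => + /eqP b0.
  by rewrite b0 mul0r addr0 => /eqP; rewrite intr_eq0 => /eqP.
have span (x : intRing K) : exists a b : int, x = a%:~R + b%:~R * w.
  have [a [b xE]] := adjoin_coord hK (val x) th1; have hx := valP x.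
  rewrite [X in X \in _]xE in hx; have [c bE] := coefP _ _ hx.
  have /d1P/dvdzP[k kE] : exists a,
    inQ a + inQ (c%:~R / (2 * d%:~R)) * th \in ringInt K by exists a; rewrite -bE.
  have E : val x - k%:~R * w0 = inQ (a - k%:~R * a1).
    rewrite xE bE kE intrM -mulrA -b1E rmorphB !rmorphM.
    by rewrite !(rmorph_int inQ) /w0; ring.
  have /ringInt_rat[m mE] : inQ (a - k%:~R * a1) \in ringInt K.
    by rewrite -E rpredB ?rpredM ?ringInt_int // (valP x).
  exists m, k; apply: val_inj; rewrite rmorphD rmorphM /= !vint /=.
  by rewrite -(rmorph_int inQ) -mE -E subrK.
exists s, w, t, n; split=> //.
  apply: val_inj; rewrite rmorphB /= vint -tE.
  by rewrite [w0 + _]addrC addrK.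
move=> a b g g0 /dvdzP[k1 k1E] /dvdzP[k2 k2E].
have g0' : (g%:~R : K) != 0.
  by rewrite -(rmorph_int inQ) fmorph_eq0 intr_eq0.
have [x xE] : exists x : intRing K, x = a%:~R + b%:~R * w by eexists.
have xx : x * x - (2 * a + t * b)%:~R * x + (bform 1 t n a b)%:~R = 0.
  transitivity (b%:~R * b%:~R * (w * w - (t%:~R * w - n%:~R))).
    rewrite xE /bform !(rmorphD, rmorphM, rmorphXn) /=; ring.
  by rewrite sqr subrr mulr0.
(* The quotient x / g has trace [k1] and norm [k2], so it is an integer; its coordinates in the
   basis are a / g and b / g. *)
have hz : val x / g%:~R \in ringInt K.
  apply: (@ringInt_quadratic _ _ k1 k2).
  have -> : (val x / g%:~R) ^+ 2 - k1%:~R * (val x / g%:~R) + k2%:~R =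
      val (x * x - (2 * a + t * b)%:~R * x + (bform 1 t n a b)%:~R) / g%:~R ^+ 2.
    have -> (u v : int) : val (x * x - u%:~R * x + v%:~R) =
        val x ^+ 2 - u%:~R * val x + v%:~R by rewrite -(vint u) -(vint v).
    by rewrite k1E k2E !rmorphM /=; field.
  by rewrite xx mul0r.
have [c [e zE]] := span (IntRing hz).
have : (a - g * c)%:~R + (b - g * e)%:~R * w = 0.
  have gz : g%:~R * IntRing hz = x.
    by apply: val_inj; rewrite rmorphM /= vint mulrC divfK.
  rewrite -[RHS](subrr x) -{2}gz zE xE !(rmorphB, rmorphM) /=; ring.
move=> /free[/eqP + /eqP]; rewrite !subr_eq0 => /eqP -> /eqP ->.
by rewrite !dvdz_mulr.
Qed.

End QuadraticIntegers.

(** * The stabiliser *)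

Section Stabiliser.
Variables (R : idomainType) (cj : {rmorphism R -> R}) (w : R) (t n : int).
Hypothesis QR : quadratic_order cj w t n.
Let N := bform 1 t n.
Let D := t ^+ 2 - 4 * n.
Variables (k : nat) (A : R -> R).
Hypotheses (k2 : (2 <= k)%N) (stA : stab (kfree k) A).

Let A_lin (m : int) (x y : R) : A (x *~ m + y) = A x *~ m + A y.
Proof. by case: stA => + _ _; apply. Qed.

Let A0 : A 0 = 0.
Proof.
have := A_lin 1 0 0; rewrite !mulr1z addr0 => /eqP.
by rewrite addrC -subr_eq subrr eq_sym => /eqP.
Qed.

Let AM (m : int) (x : R) : A (m%:~R * x) = m%:~R * A x.
Proof. by have := A_lin m x 0; rewrite A0 !addr0 !mulrzl. Qed.

Let A_elt a b : A (quad_elt w a b) = a%:~R * A 1 + b%:~R * A w.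
Proof. by rewrite /quad_elt A_lin AM -mulrzl. Qed.

Let A_kfree x : kfree k x -> kfree k (A x).
Proof. by move=> xk; case: stA => _ _; apply; exists x. Qed.

(* If p is coprime to D N(x) and x is k-free, then so are p^(k-1) x and its
   image p^(k-1) A x, so no prime above p contains A x. *)
Lemma stab_prime_dvd (p : nat) a b a' b' : prime p -> ~~ (p %| D)%Z ->
    kfree k (quad_elt w a b) -> A (quad_elt w a b) = quad_elt w a' b' ->
  (p %| N a' b')%Z -> (p %| N a b)%Z.
Proof.
move=> p_pr pD xk AxE; apply: contraTT => pN.
apply: (kfree_prime_exp_norm QR (k := k)) => //; first exact: leq_trans k2.
rewrite -AxE -rmorphXn -AM rmorphXn.
exact/A_kfree/(kfree_prime_exp QR).
Qed.

Lemma stab_form : exists al be ga : int, [/\ al != 0,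
    A 1 * cj (A 1) = al%:~R, A w * cj (A 1) + A 1 * cj (A w) = be%:~R,
    A w * cj (A w) = ga%:~R
  & forall a b a' b', A (quad_elt w a b) = quad_elt w a' b' ->
      N a' b' = bform al be ga a b].
Proof.
have [al alE] := quad_norm_ex QR (A 1); have [ga gaE] := quad_norm_ex QR (A w).
have [be] := quad_trace_ex QR (A w * cj (A 1)).
rewrite rmorphM /= (quad_cjK QR) [cj _ * A 1]mulrC => beE.
exists al, be, ga; split=> //.
  apply/eqP => al0; move/eqP: alE; rewrite al0 mulf_eq0 (quad_cj_eq0 QR) orbb.
  move=> /eqP; rewrite -A0; have [_ /bij_inj inj _] := stA.
  by move/inj/eqP; rewrite oner_eq0.
move=> a b a' b' AE; apply: (quad_int_inj QR); rewrite -(quad_normE QR) -AE A_elt.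
rewrite rmorphD !rmorphM /= !rmorph_int /bform !(rmorphD, rmorphM, rmorphXn) /=.
by rewrite -alE -beE -gaE; ring.
Qed.

Lemma dvdn_exp_bounded (q m l : nat) : (0 < q)%N ->
    (forall p, prime p -> (p %| q)%N -> (p %| m)%N) ->
    (forall p, prime p -> ~~ (p ^ l %| q)%N) ->
  (q %| m ^ l)%N.
Proof.
move=> q0 qm ql; apply/(dvdn_partP _ q0) => p; rewrite mem_primes.
case/and3P => p_pr _ pq; rewrite p_part.
apply: dvdn_trans (dvdn_exp2r l (qm _ p_pr pq)); apply: dvdn_exp2l.
by rewrite leqNgt; apply: contra (ql _ p_pr) => /ltnW; rewrite pfactor_dvdn.
Qed.

(** Subtracting al N from Q leaves b (u a + v b), and N(v, - u) is the resultant of the linear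
    factor with N. A prime dividing both Q(x) and N(x) does not divide b, since N(x) is squarefree,
    so it divides this resultant. By anisotropy the resultant vanishes only for u = v = 0. *)
Lemma stab_form_proportional (al be ga : int) : al != 0 ->
    (forall a b a' b', A (quad_elt w a b) = quad_elt w a' b' ->
      N a' b' = bform al be ga a b) ->
  be = al * t /\ ga = al * n.
Proof.
move=> al0 formE; pose u := be - al * t; pose v := ga - al * n.
suff [] : v = 0 /\ - u = 0 by rewrite /u /v; lia.
have aniso := quad_norm_aniso QR; apply: (aniso); apply/eqP/negPn/negP => R0.
pose M := absz (D * N v (- u)).

(* All primes of Q(x) divide [M] and occur with exponent below 2 k, so Q(x) divides M^(2k); the
   point is chosen to contradict exactly this. *)
have [a [b [cop sqf large]]] := squarefree_bform aniso be ga (M ^ (2 * k)) al0.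
have xk : kfree k (quad_elt w a b) by exact: (kfree_squarefree_norm QR).
have [a' [b' AE]] := quad_eltP QR (A (quad_elt w a b)).
have Axk : kfree k (quad_elt w a' b') by rewrite -AE; exact: A_kfree.
have qE := formE _ _ _ _ AE.
have M0 : (0 < M)%N by rewrite absz_gt0 mulf_neq0 ?(bform_discr_neq0 aniso).
have q0 : (0 < `|N a' b'|)%N by rewrite qE (leq_ltn_trans _ large).
move: large; apply/negP; rewrite -leqNgt -qE; apply: dvdn_leq.
  by rewrite expn_gt0 M0.
apply: (dvdn_exp_bounded q0).
  move=> p p_pr pq; have pq' : (p %| N a' b')%Z by rewrite dvdzE.
  rewrite -[M]/(absz (D * N v (- u))) -[p]/(`|p%:Z|)%N -dvdzE (Euclid_dvdzM p_pr).
  have [//|pD /=] := boolP (p %| D)%Z.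
  have pN : (p %| N a b)%Z := stab_prime_dvd p_pr pD xk AE pq'.
  have pb : ~~ (p %| b)%Z.
    apply/negP => pb; case/negP: (sqf p p_pr); apply: bform_dvd2 => //.
    exact: bform_dvdl pN pb.
  have : (p %| b * (u * a + v * b))%Z.
    have -> : b * (u * a + v * b) = N a' b' - al * N a b.
      by rewrite qE /N /bform /u /v; ring.
    by rewrite rpredB // dvdz_mull.
  rewrite (Euclid_dvdzM p_pr) (negPf pb) /= => pl.
  have : (p %| b * (b * N v (- u)))%Z.
    have -> : b * (b * N v (- u)) = u ^+ 2 * N a b
      - (u * a + v * b) * (u * a - v * b + t * u * b) by rewrite /N /bform; ring.
    by apply: rpredB; [exact: dvdz_mull | exact: dvdz_mulr].
  by rewrite !(Euclid_dvdzM p_pr) (negPf pb).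
move=> p p_pr; have := kfree_norm_exp QR p_pr Axk.
by rewrite dvdzE abszX.
Qed.

Lemma stab_quadratic : exists2 e : R, e \is a GRing.unit &
  A = mul_map e \/ A = mul_map e \o cj.
Proof.
have [al [be [ga [al0 alE beE gaE formE]]]] := stab_form.
have [beE' gaE'] := stab_form_proportional al0 formE.
(* Surjectivity enters here: for y with A y = 1, proportionality gives 1 = al N(y), so al = A 1 * cj
   (A 1) is invertible. *)
have ue : A 1 \is a GRing.unit.
  have [_ [B _ BK] _] := stA; have [a [b yE]] := quad_eltP QR (B 1).
  have A1 : A (quad_elt w a b) = quad_elt w 1 0 by rewrite -yE BK (quad_int w).
  have := formE _ _ _ _ A1; rewrite beE' gaE' => e1.
  apply/unitrPr; exists (cj (A 1) * (N a b)%:~R).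
  rewrite mulrA alE -rmorphM /= -[RHS](rmorph1 (intr : int -> R)); congr _%:~R.
  by move: e1; rewrite /N /bform => e1; lia.
set e := A 1 in ue alE beE *; exists e => //.
have al0' : (al%:~R : R) != 0 by exact: intr_neq0 QR _ _.
(* Dividing be = al t and ga = al n by al shows that [z] has trace t and norm n, so it is a root of
   the quadratic polynomial of [w]. *)
pose z := e^-1 * A w; have AwE : A w = e * z by rewrite mulVKr.
have tr : z + cj z = t%:~R.
  apply: (mulfI al0'); rewrite -intrM -beE' -beE AwE !rmorphM /= -alE; ring.
have nm : z * cj z = n%:~R.
  apply: (mulfI al0'); rewrite -intrM -gaE' -gaE AwE !rmorphM /= -alE; ring.
have : (z - w) * (z - cj w) == 0.
  rewrite (quad_conj QR).
  have -> : (z - w) * (z - (t%:~R - w)) = z * z - t%:~R * z + n%:~R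
      - (w * w - (t%:~R * w - n%:~R)) by ring.
  by rewrite (quad_sqr QR) subrr subr0 -tr -nm; apply/eqP; ring.
rewrite mulf_eq0 !subr_eq0 => /orP[] /eqP zE; [left|right];
  apply/funext => x; have [a [b ->]] := quad_eltP QR x;
  rewrite A_elt -/e AwE zE /mul_map /=.
  by rewrite /quad_elt; ring.
by rewrite /quad_elt rmorphD rmorphM /= !rmorph_int; ring.
Qed.

End Stabiliser.

(** * Semilinear maps and the semidirect product *)

Section SemilinearGroup.
Variable K : fieldExtType rat.
Implicit Types (s : 'AEnd(K)) (e x : intRing K).

Lemma gal_intK s : cancel (gal_int s) (gal_int (inv_ahom s)).
Proof. by move=> x; apply: val_inj => /=; rewrite lker0_lfunK ?AEnd_lker0. Qed.

Lemma gal_intVK s : cancel (gal_int (inv_ahom s)) (gal_int s).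
Proof. by move=> x; apply: val_inj => /=; rewrite lker0_lfunVK ?AEnd_lker0. Qed.

Lemma gal_int_id : gal_int (\1%AF : 'AEnd(K)) = id.
Proof. by apply/funext => x; apply: val_inj; rewrite /= id_lfunE. Qed.

Lemma gal_int_comp s (r : 'AEnd(K)) :
  gal_int (s \o r)%AF = gal_int s \o gal_int r.
Proof. by apply/funext => x; apply: val_inj; rewrite /= comp_lfunE. Qed.

Lemma gal_int_unit s e : e \is a GRing.unit -> gal_int s e \is a GRing.unit.
Proof. exact: rmorph_unit. Qed.

Lemma gal_int_conj s e :
  gal_int s \o mul_map e \o gal_int (inv_ahom s) = mul_map (gal_int s e).
Proof.
by apply/funext => x; rewrite /mul_map /= rmorphM /= gal_intVK.
Qed.

Lemma mul_map_comp e f : mul_map (e * f) = mul_map e \o mul_map f.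
Proof. by apply/funext => x; rewrite /mul_map /= mulrA. Qed.

Lemma mul_map_inj : injective (@mul_map (intRing K)).
Proof. by move=> e f /(congr1 (@^~ 1)); rewrite /mul_map !mulr1. Qed.

Definition int_units : set (intRing K) := [set e | e \is a GRing.unit].

Definition semilinear : set (intRing K -> intRing K) :=
  [set mul_map e \o gal_int s | e in int_units & s in [set: 'AEnd(K)]].

Lemma mul_map_group : map_group (@mul_map (intRing K) @` int_units).
Proof.
split.
- exists 1; first exact: unitr1.
  by apply/funext => x; rewrite /mul_map mul1r.
- move=> _ _ [e ue <-] [f uf <-]; exists (e * f); last exact: mul_map_comp.
  by rewrite /int_units /= unitrM; apply/andP.
- move=> _ [e ue <-]; exists (mul_map e^-1); split.
  + by exists e^-1 => //; rewrite /int_units /= unitrV.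
  + by move=> x; rewrite /mul_map mulKr.
  + by move=> x; rewrite /mul_map mulVKr.
Qed.

Lemma gal_int_group : map_group (range (@gal_int K)).
Proof.
split.
- by exists \1%AF => //; exact: gal_int_id.
- by move=> _ _ [s _ <-] [r _ <-]; exists (s \o r)%AF => //; exact: gal_int_comp.
- move=> _ [s _ <-]; exists (gal_int (inv_ahom s)).
  by split; [exists (inv_ahom s) | exact: gal_intK | exact: gal_intVK].
Qed.

Lemma semilinear_group : map_group semilinear.
Proof.
split.
- exists 1; first exact: unitr1.
  exists \1%AF => //; rewrite gal_int_id; apply/funext => x.
  by rewrite /mul_map /= mul1r.
- move=> _ _ [e ue [s _ <-]] [f uf [r _ <-]].
  exists (e * gal_int s f).
    by rewrite /int_units /= unitrM ue; exact: gal_int_unit.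
  exists (s \o r)%AF => //; rewrite gal_int_comp; apply/funext => x.
  by rewrite /mul_map /= rmorphM mulrA.
- move=> _ [e ue [s _ <-]].
  (* Solving y = e s(x) gives x = s^-1(e)^-1 s^-1(y), which is again semilinear. *)
  have uV : gal_int (inv_ahom s) e \is a GRing.unit by exact: gal_int_unit.
  exists (mul_map (gal_int (inv_ahom s) e)^-1 \o gal_int (inv_ahom s)).
  split.
  + exists (gal_int (inv_ahom s) e)^-1; last by exists (inv_ahom s).
    by rewrite /int_units /= unitrV.
  + by move=> x; rewrite /mul_map /= rmorphM /= mulKr ?gal_intK.
  + move=> x; rewrite /mul_map /= rmorphM /= gal_intVK rmorphV //= gal_intVK.
    by rewrite mulVKr.
Qed.

Lemma semilinear_sdprod :
  inner_sdprod (@mul_map (intRing K) @` int_units) (range (@gal_int K))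
    semilinear.
Proof.
split.
- split; [exact: mul_map_group | exact: gal_int_group |].
  exact: semilinear_group.
- split.
    move=> _ [e ue <-]; exists e => //; exists \1%AF => //.
    by rewrite gal_int_id.
  move=> _ [s _ <-]; exists 1; first exact: unitr1.
  by exists s => //; apply/funext => x; rewrite /mul_map /= mul1r.
- move=> g g' _ [e ue [s _ <-]] _ gK [u uu <-].
  (* Multiplications commute, so of m_e o s only [s] acts on [u]. *)
  exists (gal_int s u); first exact: gal_int_unit.
  apply/funext => x; rewrite -[in LHS](gK x) /mul_map /= rmorphM /=.
  by rewrite mulrCA.
- apply/seteqP; split=> [_ [[e ue <-] [s _ sE]]|_ ->] /=.
    (* Evaluation at 1, which every automorphism fixes, forces e = 1. *)
    apply/funext => x; suff -> : e = 1 by rewrite /mul_map mul1r.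
    by move/(congr1 (@^~ 1)): sE; rewrite rmorph1 /mul_map mulr1.
  split; last by exists \1%AF => //; exact: gal_int_id.
  by exists 1; [exact: unitr1 | apply/funext => x; rewrite /mul_map mul1r].
- apply/seteqP; split.
    move=> _ [e ue [s _ <-]]; exists (mul_map e); first by exists e.
    by exists (gal_int s) => //; exists s.
  move=> _ [_ [e ue <-] [_ [s _ <-] <-]]; exists e => //.
  by exists s.
Qed.

Hypothesis hK : \dim {:K} = 2%N.

(** An automorphism of K is determined by its value at [th], and [th] is an integer. *)
Lemma gal_int_inj : injective (@gal_int K).
Proof.
have [th [d [th1 thE]]] := exists_sqrt hK.
have th_int := ringInt_sqrt thE.
move=> s r /(congr1 (fun f => val (f (IntRing th_int)))) /= sr.
apply/val_inj/lfunP => x; have [a [b ->]] := adjoin_coord hK x th1.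
have fE (f : 'AEnd(K)) : f (a%:A + b%:A * th) = a%:A + b%:A * f th.
  by rewrite rmorphD rmorphM /= !linearZ /= rmorph1.
by rewrite [LHS]fE [RHS]fE sr.
Qed.

(** Since [semilinear] does not mention k and is a group, this one equality yields both the
    independence of k and the existence of inverses in the monoid. *)
Lemma stab_kfree k : (2 <= k)%N -> stab (@kfree (intRing K) k) = semilinear.
Proof.
move=> k2; have [s0 [w [t [n QR]]]] := exists_quadratic_order hK.
apply/seteqP; split.
  move=> A stA; have [e ue [->|->]] := stab_quadratic QR k2 stA.
    by exists e => //; exists \1%AF => //; rewrite gal_int_id.
  by exists e => //; exists s0.
move=> _ [e ue [s _ <-]]; split.
- move=> m x y; rewrite /mul_map /= rmorphD mulrDr; congr (_ + _).
  by rewrite raddfMz mulrzAr.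
- have [_ _ inv] := semilinear_group.
  have [g [_ fK gK]] : exists g, [/\ semilinear g,
      cancel (mul_map e \o gal_int s) g & cancel g (mul_map e \o gal_int s)].
    by apply: inv; exists e => //; exists s.
  by exists g.
- move=> _ [x xk <-].
  apply: (kfree_unit QR (e := e)); first exact: ue.
  exact: (kfree_autom QR (f := gal_int s) (@gal_intK s) (@gal_intVK s)).
Qed.

End SemilinearGroup.

Theorem corollary3p18 (K : fieldExtType rat) (hK : \dim {:K} = 2%N)
    (k : nat) (hk : (2 <= k)%N) :
  let units : set (intRing K) := [set e | e \is a GRing.unit] in
  let V := @kfree (intRing K) in
  [/\ map_group (stab (V k)),
      stab (V k) = stab (V 2%N),
      stab (V 2%N) =
        [set mul_map e \o gal_int s | e in units & s in [set: 'AEnd(K)]],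
      inner_sdprod (@mul_map (intRing K) @` units) (range (@gal_int K))
        (stab (V 2%N))
    & [/\ {in units &, injective (@mul_map (intRing K))},
          injective (@gal_int K),
          forall s t : 'AEnd(K), gal_int (s \o t)%AF = gal_int s \o gal_int t,
          forall e f : intRing K, mul_map (e * f) = mul_map e \o mul_map f
        & forall (s : 'AEnd(K)) (e : intRing K), e \in units ->
            gal_int s e \in units /\
            gal_int s \o mul_map e \o gal_int (inv_ahom s)
              = mul_map (gal_int s e)]].
Proof.
move=> units V; rewrite /V !stab_kfree //; split=> //.
- exact: semilinear_group.
- exact: semilinear_sdprod.
split.
- by move=> e f _ _; exact: mul_map_inj.
- exact: gal_int_inj.
- exact: gal_int_comp.
- exact: mul_map_comp.
move=> s e ue; split; last exact: gal_int_conj.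
by apply/mem_set/gal_int_unit/set_mem.
Qed.
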